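(* The following statement is provable in $\mathsf{RCA}_0$: for every partial order $\mathbf{P}$, $\mathbf{P}$ is a proper interval order if and only if $\mathbf{P}$ contains neither $\mathbf{2}\oplus\mathbf{2}$ nor $\mathbf{3}\oplus\mathbf{1}$.
   Context: $\mathsf{RCA}_0$ is the base subsystem of second-order arithmetic ($\Delta^0_1$ comprehension, $\Sigma^0_1$ induction). A partial order $\mathbf{P}=(P,\leq_P)$ is a set $P\subseteq\mathbb{N}$ with a reflexive, transitive, antisymmetric relation $\leq_P$; a linear order has any two elements comparable; $p<_P q$ means $p\leq_P q$ and $p\ne q$. $\mathbf{P}$ is a proper interval order if there are a linear order $\mathbf{L}=(L,\leq_L)$ and $F\subseteq P\times L$ such that, with $F(p)=\{x\in L:(p,x)\in F\}$: (i1) each $F(p)$ is nonempty and convex ($x,y\in F(p)$, $x<_L z<_L y$ imply $z\in F(p)$); (i2) $p<_P q$ iff $x<_L y$ for all $x\in F(p),y\in F(q)$; (i4) $F(p)\subseteq F(q)$ implies $F(p)=F(q)$ for all $p,q\in P$. $\mathbf{P}$ does not contain $\mathbf{2}\oplus\mathbf{2}$ if for all $p_0,q_0,p_1,q_1\in P$, $p_0<_P q_0$ and $p_1<_P q_1$ imply $p_0\leq_P q_1$ or $p_1\leq_P q_0$. $\mathbf{P}$ does not contain $\mathbf{3}\oplus\mathbf{1}$ if for all $p_0,p_1,p_2,q\in P$, $p_0<_P p_1<_P p_2$ implies $p_0\leq_P q$ or $q\leq_P p_2$. *)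

(* Defs.v *)
From Stdlib Require Import List.
Import ListNotations.

(** Variables are de Bruijn indices, with one index space for numbers and a
    separate one for sets: a number quantifier does not shift set variables,
    nor conversely.  As usual for L_2, equality is primitive for numbers only
    and the only set terms are set variables. *)

Inductive term : Type :=
| Var (n : nat)
| Zero
| One
| Add (s t : term)
| Mul (s t : term).

Inductive form : Type :=
| Bot
| Eq (s t : term)
| Lt (s t : term)
| In (t : term) (X : nat)
| And (A B : form)
| Or (A B : form)
| Imp (A B : form)
| AllN (A : form)
| ExN (A : form)
| AllS (A : form)
| ExS (A : form).

Definition Not (A : form) : form := Imp A Bot.
Definition Iff (A B : form) : form := And (Imp A B) (Imp B A).

Declare Scope term_scope.
Delimit Scope term_scope with term.
Bind Scope term_scope with term.
Declare Scope form_scope.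
Delimit Scope form_scope with form.
Bind Scope form_scope with form.

Arguments Add (s t)%_term.
Arguments Mul (s t)%_term.
Arguments Eq (s t)%_term.
Arguments Lt (s t)%_term.
Arguments In t%_term X.
Arguments And (A B)%_form.
Arguments Or (A B)%_form.
Arguments Imp (A B)%_form.
Arguments AllN A%_form.
Arguments ExN A%_form.
Arguments AllS A%_form.
Arguments ExS A%_form.
Arguments Not A%_form.
Arguments Iff (A B)%_form.

Notation "# n" := (Var n) (at level 1, n at level 0, format "# n") : term_scope.
Notation "0" := Zero : term_scope.
Notation "1" := One : term_scope.
Notation "s + t" := (Add s t) : term_scope.
Notation "s * t" := (Mul s t) : term_scope.
Notation "s == t" := (Eq s t) (at level 70) : form_scope.
Notation "s < t" := (Lt s t) : form_scope.
Notation "t \in X" := (In t X) (at level 70) : form_scope.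
Notation "~ A" := (Not A) : form_scope.
Notation "A /\ B" := (And A B) : form_scope.
Notation "A \/ B" := (Or A B) : form_scope.
Notation "A ==> B" := (Imp A B) (at level 90, right associativity) : form_scope.
Notation "A <==> B" := (Iff A B) (at level 95, no associativity) : form_scope.

Local Open Scope form_scope.

Definition scons {T : Type} (x : T) (f : nat -> T) (n : nat) : T :=
  match n with
  | O => x
  | S m => f m
  end.

Fixpoint subst_term (sigma : nat -> term) (t : term) : term :=
  match t with
  | Var n => sigma n
  | Zero => Zero
  | One => One
  | Add s t => Add (subst_term sigma s) (subst_term sigma t)
  | Mul s t => Mul (subst_term sigma s) (subst_term sigma t)
  end.

Definition lift_term : term -> term := subst_term (fun n => Var (S n)).

Definition upN (sigma : nat -> term) : nat -> term :=
  scons (Var 0) (fun n => lift_term (sigma n)).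

Definition upS (rho : nat -> nat) : nat -> nat :=
  scons 0 (fun n => S (rho n)).

Fixpoint subst (sigma : nat -> term) (rho : nat -> nat) (A : form) : form :=
  match A with
  | Bot => Bot
  | Eq s t => Eq (subst_term sigma s) (subst_term sigma t)
  | Lt s t => Lt (subst_term sigma s) (subst_term sigma t)
  | In t X => In (subst_term sigma t) (rho X)
  | And A B => And (subst sigma rho A) (subst sigma rho B)
  | Or A B => Or (subst sigma rho A) (subst sigma rho B)
  | Imp A B => Imp (subst sigma rho A) (subst sigma rho B)
  | AllN A => AllN (subst (upN sigma) rho A)
  | ExN A => ExN (subst (upN sigma) rho A)
  | AllS A => AllS (subst sigma (upS rho) A)
  | ExS A => ExS (subst sigma (upS rho) A)
  end.

Definition liftN : form -> form := subst (fun n => Var (S n)) (fun X => X).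
Definition liftS : form -> form := subst Var S.

Definition instN (t : term) : form -> form :=
  subst (scons t Var) (fun X => X).
Definition instS (X : nat) : form -> form :=
  subst Var (scons X (fun Y => Y)).

(** The eigenvariable conditions of the quantifier rules are expressed by
    lifting the context, but not the theory [T]: free variables of the axioms
    in [T] are read as universally quantified. *)

Inductive proves (T : form -> Prop) : list form -> form -> Prop :=
| prAx Gamma A : T A -> proves T Gamma A
| prHyp Gamma A : List.In A Gamma -> proves T Gamma A
| prRaa Gamma A : proves T ((~ A) :: Gamma) Bot -> proves T Gamma A
| prAndI Gamma A B :
    proves T Gamma A -> proves T Gamma B -> proves T Gamma (A /\ B)
| prAndE1 Gamma A B : proves T Gamma (A /\ B) -> proves T Gamma A
| prAndE2 Gamma A B : proves T Gamma (A /\ B) -> proves T Gamma B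
| prOrI1 Gamma A B : proves T Gamma A -> proves T Gamma (A \/ B)
| prOrI2 Gamma A B : proves T Gamma B -> proves T Gamma (A \/ B)
| prOrE Gamma A B C :
    proves T Gamma (A \/ B) ->
    proves T (A :: Gamma) C -> proves T (B :: Gamma) C -> proves T Gamma C
| prImpI Gamma A B : proves T (A :: Gamma) B -> proves T Gamma (A ==> B)
| prImpE Gamma A B :
    proves T Gamma (A ==> B) -> proves T Gamma A -> proves T Gamma B
| prAllNI Gamma A : proves T (map liftN Gamma) A -> proves T Gamma (AllN A)
| prAllNE Gamma A t : proves T Gamma (AllN A) -> proves T Gamma (instN t A)
| prExNI Gamma A t : proves T Gamma (instN t A) -> proves T Gamma (ExN A)
| prExNE Gamma A C :
    proves T Gamma (ExN A) ->
    proves T (A :: map liftN Gamma) (liftN C) -> proves T Gamma C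
| prAllSI Gamma A : proves T (map liftS Gamma) A -> proves T Gamma (AllS A)
| prAllSE Gamma A X : proves T Gamma (AllS A) -> proves T Gamma (instS X A)
| prExSI Gamma A X : proves T Gamma (instS X A) -> proves T Gamma (ExS A)
| prExSE Gamma A C :
    proves T Gamma (ExS A) ->
    proves T (A :: map liftS Gamma) (liftS C) -> proves T Gamma C
| prEqI Gamma t : proves T Gamma (t == t)
| prEqE Gamma s t A :
    proves T Gamma (s == t) ->
    proves T Gamma (instN s A) -> proves T Gamma (instN t A).

Definition provable (T : form -> Prop) (A : form) : Prop := proves T [] A.

Inductive delta00 : form -> Prop :=
| d00Bot : delta00 Bot
| d00Eq s t : delta00 (s == t)
| d00Lt s t : delta00 (s < t)
| d00In t X : delta00 (t \in X)
| d00And A B : delta00 A -> delta00 B -> delta00 (A /\ B)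
| d00Or A B : delta00 A -> delta00 B -> delta00 (A \/ B)
| d00Imp A B : delta00 A -> delta00 B -> delta00 (A ==> B)
| d00All t A : delta00 A -> delta00 (AllN (#0 < lift_term t ==> A))
| d00Ex t A : delta00 A -> delta00 (ExN (#0 < lift_term t /\ A)).

Inductive sigma01 : form -> Prop :=
| s01Ex A : delta00 A -> sigma01 (ExN A).

Inductive pi01 : form -> Prop :=
| p01All A : delta00 A -> pi01 (AllN A).

Definition succ_subst : nat -> term := scons (#0 + 1)%term (fun n => Var (S n)).

Definition induction (A : form) : form :=
  instN 0 A /\ AllN (A ==> subst succ_subst (fun X => X) A) ==> AllN A.

(** [liftS] keeps the comprehended set from occurring in [A]. *)
Definition comprehension (A B : form) : form :=
  AllN (A <==> B) ==> ExS (AllN (#0 \in 0 <==> liftS A)).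

Inductive RCA0 : form -> Prop :=
| axSuccNeqZero : RCA0 (~ #0 + 1 == 0)
| axSuccInj : RCA0 (#1 + 1 == #0 + 1 ==> #1 == #0)
| axAddZero : RCA0 (#0 + 0 == #0)
| axAddSucc : RCA0 (#1 + (#0 + 1) == (#1 + #0) + 1)
| axMulZero : RCA0 (#0 * 0 == 0)
| axMulSucc : RCA0 (#1 * (#0 + 1) == #1 * #0 + #1)
| axLtZero : RCA0 (~ #0 < 0)
| axLtSucc : RCA0 (#1 < #0 + 1 <==> (#1 < #0 \/ #1 == #0))
| axInduction A : sigma01 A -> RCA0 (induction A)
| axComprehension A B :
    sigma01 A -> pi01 B -> RCA0 (comprehension A B).

(** A binary relation is a set of codes of pairs, for the pairing
    (m, n) |-> (m + n)^2 + m, which is injective provably in RCA_0.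
    An order (P, <=_P) is given by set variables [P] and [R]. *)

Definition pair (s t : term) : term := ((s + t) * (s + t) + s)%term.

Definition rel (R : nat) (s t : term) : form := pair s t \in R.

Definition srel (R : nat) (s t : term) : form := rel R s t /\ ~ s == t.

Definition sub_prod (R X Y : nat) : form :=
  AllN (#0 \in R ==>
    ExN (ExN (#1 \in X /\ #0 \in Y /\ #2 == pair #1 #0))).

Definition partial_order (P R : nat) : form :=
  sub_prod R P P /\
  AllN (#0 \in P ==> rel R #0 #0) /\
  AllN (AllN (AllN (
    let p := #2%term in let q := #1%term in let r := #0%term in
    p \in P /\ q \in P /\ r \in P ==>
    rel R p q /\ rel R q r ==> rel R p r))) /\
  AllN (AllN (
    let p := #1%term in let q := #0%term in
    p \in P /\ q \in P ==> rel R p q /\ rel R q p ==> p == q)).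

Definition linear_order (L S : nat) : form :=
  partial_order L S /\
  AllN (AllN (
    let x := #1%term in let y := #0%term in
    x \in L /\ y \in L ==> rel S x y \/ rel S y x)).

(** [x] is an element of F(p) = {x in L : (p, x) in F}. *)
Definition mem_at (L F : nat) (x p : term) : form := x \in L /\ rel F p x.

Definition i1 (P L S F : nat) : form :=
  AllN (#0 \in P ==> ExN (mem_at L F #0 #1)) /\
  AllN (#0 \in P ==> AllN (AllN (AllN (
    let p := #3%term in
    let x := #2%term in let y := #1%term in let z := #0%term in
    mem_at L F x p /\ mem_at L F y p /\ z \in L ==>
    srel S x z /\ srel S z y ==> mem_at L F z p)))).

Definition i2 (P R L S F : nat) : form :=
  AllN (AllN (#1 \in P /\ #0 \in P ==>
    (srel R #1 #0 <==>
     AllN (AllN (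
       let p := #3%term in let q := #2%term in
       let x := #1%term in let y := #0%term in
       mem_at L F x p /\ mem_at L F y q ==> srel S x y))))).

Definition i4 (P L F : nat) : form :=
  AllN (AllN (#1 \in P /\ #0 \in P ==>
    AllN (mem_at L F #0 #2 ==> mem_at L F #0 #1) ==>
    AllN (mem_at L F #0 #2 <==> mem_at L F #0 #1))).

Definition proper_interval_order (P R : nat) : form :=
  let P' := S (S (S P)) in
  let R' := S (S (S R)) in
  let L := 2 in let leL := 1 in let F := 0 in
  ExS (ExS (ExS (
    linear_order L leL /\ sub_prod F P' L /\
    i1 P' L leL F /\ i2 P' R' L leL F /\ i4 P' L F))).

Definition no_two_plus_two (P R : nat) : form :=
  AllN (AllN (AllN (AllN (
    let p0 := #3%term in let q0 := #2%term in
    let p1 := #1%term in let q1 := #0%term in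
    p0 \in P /\ q0 \in P /\ p1 \in P /\ q1 \in P ==>
    srel R p0 q0 /\ srel R p1 q1 ==> rel R p0 q1 \/ rel R p1 q0)))).

Definition no_three_plus_one (P R : nat) : form :=
  AllN (AllN (AllN (AllN (
    let p0 := #3%term in let p1 := #2%term in
    let p2 := #1%term in let q := #0%term in
    p0 \in P /\ p1 \in P /\ p2 \in P /\ q \in P ==>
    srel R p0 p1 /\ srel R p1 p2 ==> rel R p0 q \/ rel R q p2)))).

(* Main.v *)
(** By completeness it suffices to prove the equivalence in every (possibly
    nonstandard) structure satisfying RCA_0.

    For a representation of an order without 2+2 and 3+1, think of each [p] as
    a unit interval [pos p, pos p + 1].  A point [x] of the linear order is a
    cut of the positions [pos p] and [pos p + 1], and [p] is incident to [x]
    when [pos p] is on the left and [pos p + 1] on the right of [x].  Only the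
    comparison of [pos v + 1] with [pos u] is decidable, so cuts are found
    greedily: "left" items [pos u] want to lie left of the cut, "right" items
    [pos v + 1] want to lie right of it, a right item conflicts with a left
    item when [v < u], and items are accepted in the order of their codes
    unless they conflict with an accepted one.  Since the conflict relation is
    Ferrers, acceptance has a bounded-quantifier definition and no recursion is
    needed; two greedy cuts are compared by asking on which side each puts the
    two initial items of the other.  To make the representation proper, the
    items [pos u + 2] (on the left) or [pos v - 1] (on the right) also take
    part, in two separate families of cuts: they turn a cut separating two left
    endpoints into one separating the corresponding right endpoints, and
    conversely. *)

From Stdlib Require Import List Arith Lia Cantor Classical ClassicalEpsilon
  FunctionalExtensionality PropExtensionality Ring.
Require Import Defs.
Import ListNotations.

(** * Substitution in derivations *)

Lemma upN_Var : upN Var = Var.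
Proof. apply functional_extensionality; intros [|n]; reflexivity. Qed.

Lemma upS_id : upS (fun X => X) = (fun X => X).
Proof. apply functional_extensionality; intros [|n]; reflexivity. Qed.

Lemma subst_term_Var t : subst_term Var t = t.
Proof. induction t; cbn; congruence. Qed.

Lemma subst_id A : subst Var (fun X => X) A = A.
Proof.
induction A; cbn; rewrite ?upN_Var, ?upS_id, ?subst_term_Var; congruence.
Qed.

Lemma subst_term_comp sigma tau t :
  subst_term tau (subst_term sigma t) =
  subst_term (fun n => subst_term tau (sigma n)) t.
Proof. induction t; cbn; congruence. Qed.

Lemma upN_comp sigma tau :
  (fun n => subst_term (upN tau) (upN sigma n)) =
  upN (fun n => subst_term tau (sigma n)).
Proof.
apply functional_extensionality; intros [|n]; [reflexivity|].
cbn; unfold lift_term; now rewrite !subst_term_comp.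
Qed.

Lemma upS_comp (rho rho' : nat -> nat) :
  (fun X => upS rho' (upS rho X)) = upS (fun X => rho' (rho X)).
Proof. apply functional_extensionality; intros [|n]; reflexivity. Qed.

Lemma subst_comp A : forall sigma rho tau rho',
  subst tau rho' (subst sigma rho A) =
  subst (fun n => subst_term tau (sigma n)) (fun X => rho' (rho X)) A.
Proof.
induction A; intros; cbn;
  rewrite ?IHA, ?IHA1, ?IHA2, ?upN_comp, ?upS_comp, ?subst_term_comp;
  reflexivity.
Qed.

Lemma instN_upN t sigma rho A :
  instN t (subst (upN sigma) rho A) = subst (scons t sigma) rho A.
Proof.
unfold instN; rewrite subst_comp; f_equal.
apply functional_extensionality; intros [|n]; [reflexivity|].
cbn; unfold lift_term; rewrite subst_term_comp; apply subst_term_Var.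
Qed.

Lemma instS_upS X sigma rho A :
  instS X (subst sigma (upS rho) A) = subst sigma (scons X rho) A.
Proof.
unfold instS; rewrite subst_comp; f_equal;
  apply functional_extensionality; intros n.
- apply subst_term_Var.
- destruct n; reflexivity.
Qed.

Lemma subst_instN t sigma rho A :
  subst sigma rho (instN t A) =
  instN (subst_term sigma t) (subst (upN sigma) rho A).
Proof.
rewrite instN_upN; unfold instN; rewrite subst_comp; f_equal.
apply functional_extensionality; intros [|n]; reflexivity.
Qed.

Lemma subst_instS X sigma rho A :
  subst sigma rho (instS X A) = instS (rho X) (subst sigma (upS rho) A).
Proof.
rewrite instS_upS; unfold instS; rewrite subst_comp; f_equal.
apply functional_extensionality; intros [|n]; reflexivity.
Qed.

Lemma liftN_subst sigma rho A :
  liftN (subst sigma rho A) = subst (upN sigma) rho (liftN A).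
Proof. unfold liftN; now rewrite !subst_comp. Qed.

Lemma liftS_subst sigma rho A :
  liftS (subst sigma rho A) = subst sigma (upS rho) (liftS A).
Proof.
unfold liftS; rewrite !subst_comp; f_equal.
apply functional_extensionality; intros n; apply subst_term_Var.
Qed.

Lemma map_liftN_subst sigma rho Gamma :
  map liftN (map (subst sigma rho) Gamma) =
  map (subst (upN sigma) rho) (map liftN Gamma).
Proof. rewrite !map_map; apply map_ext; intros; apply liftN_subst. Qed.

Lemma map_liftS_subst sigma rho Gamma :
  map liftS (map (subst sigma rho) Gamma) =
  map (subst sigma (upS rho)) (map liftS Gamma).
Proof. rewrite !map_map; apply map_ext; intros; apply liftS_subst. Qed.

(** * Finite support of formulas and contexts *)

(** Free variables are never computed: having none from [k] on is expressed by insensitivity to the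
    values of a substitution there. One bound serves both index spaces. *)
Definition bounded (k : nat) (A : form) : Prop :=
  forall sigma sigma' rho rho',
    (forall i, (i < k)%nat -> sigma i = sigma' i /\ rho i = rho' i) ->
    subst sigma rho A = subst sigma' rho' A.

Lemma bounded_le k l A : (k <= l)%nat -> bounded k A -> bounded l A.
Proof. intros Hkl HA s s' r r' H; apply HA; intros i Hi; apply H; lia. Qed.

Lemma term_bound t : exists k, forall sigma sigma',
  (forall i, (i < k)%nat -> sigma i = sigma' i) ->
  subst_term sigma t = subst_term sigma' t.
Proof.
induction t as [n| | |s [k Hk] t [l Hl]|s [k Hk] t [l Hl]].
- exists (S n); cbn; intros; auto.
- exists 0%nat; reflexivity.
- exists 0%nat; reflexivity.
- exists (k + l); intros; cbn; f_equal; [apply Hk|apply Hl];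
    intros; apply H; lia.
- exists (k + l); intros; cbn; f_equal; [apply Hk|apply Hl];
    intros; apply H; lia.
Qed.

Lemma form_bound A : exists k, bounded k A.
Proof.
induction A as [|s t|s t|t X|A [k Hk] B [l Hl]|A [k Hk] B [l Hl]
  |A [k Hk] B [l Hl]|A [k Hk]|A [k Hk]|A [k Hk]|A [k Hk]].
- exists 0%nat; intros ?; reflexivity.
- destruct (term_bound s) as [k Hk], (term_bound t) as [l Hl].
  exists (k + l); intros ? ? ? ? H; cbn; f_equal; [apply Hk|apply Hl];
    intros; apply H; lia.
- destruct (term_bound s) as [k Hk], (term_bound t) as [l Hl].
  exists (k + l); intros ? ? ? ? H; cbn; f_equal; [apply Hk|apply Hl];
    intros; apply H; lia.
- destruct (term_bound t) as [k Hk].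
  exists (k + S X); intros ? ? ? ? H; cbn; f_equal.
  + apply Hk; intros; apply H; lia.
  + apply H; lia.
- exists (k + l); intros ? ? ? ? H; cbn; f_equal; [apply Hk|apply Hl];
    intros; apply H; lia.
- exists (k + l); intros ? ? ? ? H; cbn; f_equal; [apply Hk|apply Hl];
    intros; apply H; lia.
- exists (k + l); intros ? ? ? ? H; cbn; f_equal; [apply Hk|apply Hl];
    intros; apply H; lia.
- exists k; intros ? ? ? ? H; cbn; f_equal; apply Hk; intros [|i] Hi.
  + split; [reflexivity|now apply H].
  + split; [|now apply H]. cbn; unfold lift_term; f_equal; apply H; lia.
- exists k; intros ? ? ? ? H; cbn; f_equal; apply Hk; intros [|i] Hi.
  + split; [reflexivity|now apply H].
  + split; [|now apply H]. cbn; unfold lift_term; f_equal; apply H; lia.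
- exists k; intros ? ? ? ? H; cbn; f_equal; apply Hk; intros [|i] Hi.
  + split; [now apply H|reflexivity].
  + split; [now apply H|]. cbn; f_equal; apply H; lia.
- exists k; intros ? ? ? ? H; cbn; f_equal; apply Hk; intros [|i] Hi.
  + split; [now apply H|reflexivity].
  + split; [now apply H|]. cbn; f_equal; apply H; lia.
Qed.

Lemma context_bound Gamma : exists k, forall A, List.In A Gamma -> bounded k A.
Proof.
induction Gamma as [|A Gamma [k Hk]].
- exists 0%nat; intros ? [].
- destruct (form_bound A) as [l Hl]; exists (k + l); intros B [<-|HB].
  + apply (bounded_le l); [lia|assumption].
  + apply (bounded_le k); [lia|auto].
Qed.

Section Provability.

Variable T : form -> Prop.
Notation "Gamma |- A" := (proves T Gamma A) (at level 68).

Lemma weakening Gamma A :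
  Gamma |- A -> forall Delta, incl Gamma Delta -> Delta |- A.
Proof.
induction 1; intros Delta HD.
- now apply prAx.
- apply prHyp; auto.
- apply prRaa, IHproves; intros B [<-|HB]; [now left|right; auto].
- apply prAndI; auto.
- eapply prAndE1; eauto.
- eapply prAndE2; eauto.
- apply prOrI1; auto.
- apply prOrI2; auto.
- eapply prOrE; [eauto|apply IHproves2|apply IHproves3];
    (intros D [<-|HB]; [now left|right; auto]).
- apply prImpI, IHproves; intros D [<-|HB]; [now left|right; auto].
- eapply prImpE; eauto.
- apply prAllNI, IHproves; now apply incl_map.
- apply prAllNE; auto.
- eapply prExNI; eauto.
- eapply prExNE; [eauto|apply IHproves2].
  intros D [<-|HB]; [now left|right; revert HB; now apply incl_map].
- apply prAllSI, IHproves; now apply incl_map.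
- apply prAllSE; auto.
- eapply prExSI; eauto.
- eapply prExSE; [eauto|apply IHproves2].
  intros D [<-|HB]; [now left|right; revert HB; now apply incl_map].
- apply prEqI.
- eapply prEqE; eauto.
Qed.

(** The pending substitution [sigma] carries the induction: eliminating the outermost quantifier
    with [v k] extends [sigma], and the [k] inner quantifiers are then treated under the extended
    one. *)
Lemma instN_iter k A : forall Gamma sigma rho v,
  Gamma |- subst sigma rho (Nat.iter k AllN A) ->
  Gamma |- subst (fun n => if n <? k then v n else sigma (n - k)) rho A.
Proof.
induction k as [|k IH]; intros Gamma sigma rho v H; cbn in H.
- replace (fun n => _) with sigma; [assumption|].
  apply functional_extensionality; intros n; cbn; f_equal; lia.
- apply (prAllNE _ _ _ (v k)) in H; rewrite instN_upN in H.
  apply (IH _ _ _ v) in H.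
  replace (fun n => if n <? S k then v n else sigma (n - S k)) with
    (fun n => if n <? k then v n else scons (v k) sigma (n - k)); [assumption|].
  apply functional_extensionality; intros n.
  destruct (Nat.ltb_spec n k), (Nat.ltb_spec n (S k)); try lia; auto.
  + replace n with k by lia; now rewrite Nat.sub_diag.
  + replace (n - k) with (S (n - S k)) by lia; reflexivity.
Qed.

Lemma instS_iter k A : forall Gamma sigma rho v,
  Gamma |- subst sigma rho (Nat.iter k AllS A) ->
  Gamma |- subst sigma (fun n => if n <? k then v n else rho (n - k)) A.
Proof.
induction k as [|k IH]; intros Gamma sigma rho v H; cbn in H.
- replace (fun n => if n <? 0 then v n else rho (n - 0)) with rho; [assumption|].
  apply functional_extensionality; intros n; cbn; f_equal; lia.
- apply (prAllSE _ _ _ (v k)) in H; rewrite instS_upS in H.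
  apply (IH _ _ _ v) in H.
  replace (fun n => if n <? S k then v n else rho (n - S k)) with
    (fun n => if n <? k then v n else scons (v k) rho (n - k)); [assumption|].
  apply functional_extensionality; intros n.
  destruct (Nat.ltb_spec n k), (Nat.ltb_spec n (S k)); try lia; auto.
  + replace n with k by lia; now rewrite Nat.sub_diag.
  + replace (n - k) with (S (n - S k)) by lia; reflexivity.
Qed.

(** Axioms remain available under the quantifier rules, so they can be
    universally closed and then instantiated. *)
Lemma axiom_subst A : T A -> forall Gamma sigma rho, Gamma |- subst sigma rho A.
Proof.
intros HA Gamma sigma rho.
assert (HN : forall sigma Gamma, Gamma |- subst sigma (fun X => X) A).
{ clear Gamma sigma; intros sigma Gamma; destruct (form_bound A) as [k Hk].
  assert (H : forall j Gamma, Gamma |- Nat.iter j AllN A).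
  { induction j; intros; cbn; [now apply prAx|apply prAllNI, IHj]. }
  specialize (H k Gamma); rewrite <- subst_id in H.
  apply (instN_iter _ _ _ _ _ sigma) in H.
  erewrite Hk; [exact H|]; intros i Hi; split; [|reflexivity].
  now rewrite (proj2 (Nat.ltb_lt i k) Hi). }
replace (subst sigma rho A) with (subst Var rho (subst sigma (fun X => X) A)).
2:{ rewrite subst_comp; f_equal; apply functional_extensionality; intros n.
    apply subst_term_Var. }
set (B := subst sigma (fun X => X) A); destruct (form_bound B) as [k Hk].
assert (H : forall j Gamma, Gamma |- Nat.iter j AllS B).
{ induction j; intros; cbn; [apply HN|apply prAllSI, IHj]. }
specialize (H k Gamma); rewrite <- subst_id in H.
apply (instS_iter _ _ _ _ _ rho) in H.
erewrite Hk; [exact H|]; intros i Hi; split; [reflexivity|].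
now rewrite (proj2 (Nat.ltb_lt i k) Hi).
Qed.

(** Needed to rename a fresh variable to the eigenvariable of an existential rule. The axiom case is
    [axiom_subst]; in the quantifier rules the lifted context commutes with the lifted
    substitution. *)
Lemma proves_subst Gamma A : Gamma |- A -> forall sigma rho,
  map (subst sigma rho) Gamma |- subst sigma rho A.
Proof.
induction 1; intros sigma rho; cbn in *.
- now apply axiom_subst.
- apply prHyp; now apply in_map.
- apply prRaa; apply IHproves.
- apply prAndI; auto.
- eapply prAndE1; apply IHproves.
- eapply prAndE2; apply IHproves.
- apply prOrI1; auto.
- apply prOrI2; auto.
- eapply prOrE; [apply IHproves1|apply IHproves2|apply IHproves3].
- apply prImpI; apply IHproves.
- eapply prImpE; [apply IHproves1|apply IHproves2].
- apply prAllNI; rewrite map_liftN_subst; apply IHproves.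
- rewrite subst_instN; apply prAllNE, IHproves.
- apply (prExNI _ _ _ (subst_term sigma t)); rewrite <- subst_instN; apply IHproves.
- eapply prExNE; [apply IHproves1|].
  rewrite map_liftN_subst, liftN_subst; apply IHproves2.
- apply prAllSI; rewrite map_liftS_subst; apply IHproves.
- rewrite subst_instS; apply prAllSE, IHproves.
- apply (prExSI _ _ _ (rho X)); rewrite <- subst_instS; apply IHproves.
- eapply prExSE; [apply IHproves1|].
  rewrite map_liftS_subst, liftS_subst; apply IHproves2.
- apply prEqI.
- rewrite subst_instN; eapply prEqE; [apply IHproves1|].
  rewrite <- subst_instN; apply IHproves2.
Qed.

(** * Henkin witnesses for consistent contexts *)

Definition consistent (Gamma : list form) : Prop := ~ (Gamma |- Bot).

(** A variable [k] beyond the support of the context is a witness. Were it inconsistent, sending [k]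
    to [0] and every other [n] to [S n] would turn the refutation into the premise of [prExNE] with
    conclusion [Bot]. *)
Lemma henkin_ExN Gamma A : consistent (ExN A :: Gamma) ->
  exists t, consistent (instN t A :: ExN A :: Gamma).
Proof.
intros HC; destruct (context_bound (A :: ExN A :: Gamma)) as [k Hk].
exists (Var k); intros HB; apply HC; eapply prExNE.
{ apply prHyp; now left. }
apply (proves_subst _ _) with (sigma := fun n => if n =? k then Var 0 else Var (S n))
  (rho := fun X => X) in HB.
eapply weakening; [exact HB|].
set (sg := fun n => _) in *.
assert (HL : forall B, List.In B (ExN A :: Gamma) -> subst sg (fun X => X) B = liftN B).
{ intros B HBin; apply (Hk B); [now right|]; intros i Hi; split; [|reflexivity].
  unfold sg; destruct (Nat.eqb_spec i k); [lia|reflexivity]. }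
change (map ?f (?a :: ?l)) with (f a :: map f l) at 1.
apply incl_cons.
- left; unfold instN; rewrite subst_comp; symmetry.
  etransitivity; [|apply subst_id]; apply (Hk A); [now left|].
  intros [|i] Hi; (split; [|reflexivity]); cbn.
  + unfold sg; now rewrite Nat.eqb_refl.
  + unfold sg; destruct (Nat.eqb_spec i k); [lia|reflexivity].
- rewrite (map_ext_in _ liftN _ HL); apply incl_tl, incl_refl.
Qed.

Lemma henkin_ExS Gamma A : consistent (ExS A :: Gamma) ->
  exists X, consistent (instS X A :: ExS A :: Gamma).
Proof.
intros HC; destruct (context_bound (A :: ExS A :: Gamma)) as [k Hk].
exists k; intros HB; apply HC; eapply prExSE.
{ apply prHyp; now left. }
apply (proves_subst _ _) with (sigma := Var)
  (rho := fun X => if X =? k then 0 else S X) in HB.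
eapply weakening; [exact HB|].
set (rh := fun n => _) in *.
assert (HL : forall B, List.In B (ExS A :: Gamma) -> subst Var rh B = liftS B).
{ intros B HBin; apply (Hk B); [now right|]; intros i Hi; split; [reflexivity|].
  unfold rh; destruct (Nat.eqb_spec i k); [lia|reflexivity]. }
change (map ?f (?a :: ?l)) with (f a :: map f l) at 1.
apply incl_cons.
- left; unfold instS; rewrite subst_comp; symmetry.
  etransitivity; [|apply subst_id]; apply (Hk A); [now left|].
  intros [|i] Hi; (split; [reflexivity|]); cbn.
  + unfold rh; now rewrite Nat.eqb_refl.
  + unfold rh; destruct (Nat.eqb_spec i k); [lia|reflexivity].
- rewrite (map_ext_in _ liftS _ HL); apply incl_tl, incl_refl.
Qed.

(** One stage of the Lindenbaum construction: [A] is added together with a witness whenever that is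
    consistent, and otherwise the context stays as it is. *)
Lemma henkin_step Gamma A : consistent Gamma ->
  exists Delta, consistent Delta /\ incl Gamma Delta /\
    (consistent (A :: Gamma) -> List.In A Delta /\
      (forall B, A = ExN B -> exists t, List.In (instN t B) Delta) /\
      (forall B, A = ExS B -> exists X, List.In (instS X B) Delta)).
Proof.
intros HG; destruct (classic (consistent (A :: Gamma))) as [HA|HA].
2:{ exists Gamma; repeat split; auto using incl_refl; tauto. }
destruct A as [| | | | | | | |B| |B].
all: try (eexists; repeat split; [exact HA|apply incl_tl, incl_refl|now left| |];
  discriminate).
- destruct (henkin_ExN _ _ HA) as [t Ht].
  eexists; repeat split; [exact Ht|do 2 apply incl_tl; apply incl_refl
    |right; now left| |discriminate].
  intros C [= <-]; exists t; now left.
- destruct (henkin_ExS _ _ HA) as [t Ht].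
  eexists; repeat split; [exact Ht|do 2 apply incl_tl; apply incl_refl
    |right; now left|discriminate|].
  intros C [= <-]; exists t; now left.
Qed.

End Provability.

(** * Completeness *)

Fixpoint decode_term (fuel n : nat) : term :=
  match fuel with
  | O => Zero
  | S f =>
    let (k, m) := of_nat n in
    let (a, b) := of_nat m in
    match k with
    | 0 => Var m
    | 1 => Zero
    | 2 => One
    | 3 => Add (decode_term f a) (decode_term f b)
    | _ => Mul (decode_term f a) (decode_term f b)
    end
  end.

Fixpoint decode_form (fuel n : nat) : form :=
  match fuel with
  | O => Bot
  | S f =>
    let (k, m) := of_nat n in
    let (a, b) := of_nat m in
    match k with
    | 0 => Bot
    | 1 => Eq (decode_term f a) (decode_term f b)
    | 2 => Lt (decode_term f a) (decode_term f b)
    | 3 => In (decode_term f a) b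
    | 4 => And (decode_form f a) (decode_form f b)
    | 5 => Or (decode_form f a) (decode_form f b)
    | 6 => Imp (decode_form f a) (decode_form f b)
    | 7 => AllN (decode_form f m)
    | 8 => ExN (decode_form f m)
    | 9 => AllS (decode_form f m)
    | _ => ExS (decode_form f m)
    end
  end.

(** Asking for all large fuels lets the two subterms of a compound term be decoded with the same
    fuel. *)
Lemma decode_term_surj t : exists k, forall f, k <= f -> exists n, decode_term f n = t.
Proof.
induction t as [n| | |s [k Hk] t [l Hl]|s [k Hk] t [l Hl]].
1: exists 1; intros [|f] Hf; [lia|]; exists (to_nat (0, n)).
2: exists 1; intros [|f] Hf; [lia|]; exists (to_nat (1, 0)).
3: exists 1; intros [|f] Hf; [lia|]; exists (to_nat (2, 0)).
1-3: cbn -[of_nat to_nat]; rewrite cancel_of_to; destruct of_nat; reflexivity.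
all: exists (S (k + l)); intros [|f] Hf; [lia|].
all: destruct (Hk f) as [a Ha]; [lia|]; destruct (Hl f) as [b Hb]; [lia|].
1: exists (to_nat (3, to_nat (a, b))).
2: exists (to_nat (4, to_nat (a, b))).
all: cbn -[of_nat to_nat]; rewrite !cancel_of_to; congruence.
Qed.

Lemma decode_form_surj A : exists k, forall f, k <= f -> exists n, decode_form f n = A.
Proof.
induction A as [|s t|s t|t X|A [k Hk] B [l Hl]|A [k Hk] B [l Hl]
  |A [k Hk] B [l Hl]|A [k Hk]|A [k Hk]|A [k Hk]|A [k Hk]].
- exists 1; intros [|f] Hf; [lia|]; exists (to_nat (0, 0)).
  cbn -[of_nat to_nat]; rewrite cancel_of_to; destruct of_nat; reflexivity.
- destruct (decode_term_surj s) as [k Hk], (decode_term_surj t) as [l Hl].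
  exists (S (k + l)); intros [|f] Hf; [lia|].
  destruct (Hk f) as [a Ha]; [lia|]; destruct (Hl f) as [b Hb]; [lia|].
  exists (to_nat (1, to_nat (a, b))).
  cbn -[of_nat to_nat]; rewrite !cancel_of_to; congruence.
- destruct (decode_term_surj s) as [k Hk], (decode_term_surj t) as [l Hl].
  exists (S (k + l)); intros [|f] Hf; [lia|].
  destruct (Hk f) as [a Ha]; [lia|]; destruct (Hl f) as [b Hb]; [lia|].
  exists (to_nat (2, to_nat (a, b))).
  cbn -[of_nat to_nat]; rewrite !cancel_of_to; congruence.
- destruct (decode_term_surj t) as [k Hk].
  exists (S k); intros [|f] Hf; [lia|].
  destruct (Hk f) as [a Ha]; [lia|].
  exists (to_nat (3, to_nat (a, X))).
  cbn -[of_nat to_nat]; rewrite !cancel_of_to; congruence.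
- exists (S (k + l)); intros [|f] Hf; [lia|].
  destruct (Hk f) as [a Ha]; [lia|]; destruct (Hl f) as [b Hb]; [lia|].
  exists (to_nat (4, to_nat (a, b))).
  cbn -[of_nat to_nat]; rewrite !cancel_of_to; congruence.
- exists (S (k + l)); intros [|f] Hf; [lia|].
  destruct (Hk f) as [a Ha]; [lia|]; destruct (Hl f) as [b Hb]; [lia|].
  exists (to_nat (5, to_nat (a, b))).
  cbn -[of_nat to_nat]; rewrite !cancel_of_to; congruence.
- exists (S (k + l)); intros [|f] Hf; [lia|].
  destruct (Hk f) as [a Ha]; [lia|]; destruct (Hl f) as [b Hb]; [lia|].
  exists (to_nat (6, to_nat (a, b))).
  cbn -[of_nat to_nat]; rewrite !cancel_of_to; congruence.
- exists (S k); intros [|f] Hf; [lia|].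
  destruct (Hk f) as [a Ha]; [lia|]; exists (to_nat (7, a)).
  cbn -[of_nat to_nat]; rewrite !cancel_of_to; destruct of_nat; congruence.
- exists (S k); intros [|f] Hf; [lia|].
  destruct (Hk f) as [a Ha]; [lia|]; exists (to_nat (8, a)).
  cbn -[of_nat to_nat]; rewrite !cancel_of_to; destruct of_nat; congruence.
- exists (S k); intros [|f] Hf; [lia|].
  destruct (Hk f) as [a Ha]; [lia|]; exists (to_nat (9, a)).
  cbn -[of_nat to_nat]; rewrite !cancel_of_to; destruct of_nat; congruence.
- exists (S k); intros [|f] Hf; [lia|].
  destruct (Hk f) as [a Ha]; [lia|]; exists (to_nat (10, a)).
  cbn -[of_nat to_nat]; rewrite !cancel_of_to; destruct of_nat; congruence.
Qed.

(** The fuel is part of the code, so a single number fixes both the recursion depth and the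
    formula. *)
Definition form_enum (n : nat) : form := let (f, m) := of_nat n in decode_form f m.

Lemma form_enum_surj A : exists n, form_enum n = A.
Proof.
destruct (decode_form_surj A) as [k Hk]; destruct (Hk k (le_n k)) as [n Hn].
exists (to_nat (k, n)); unfold form_enum; now rewrite cancel_of_to.
Qed.

(** * Structures and satisfaction *)

Record structure : Type := Structure {
  num : Type;
  set : Type;
  zero : num;
  one : num;
  add : num -> num -> num;
  mul : num -> num -> num;
  lt : num -> num -> Prop;
  mem : num -> set -> Prop
}.

Fixpoint eval (M : structure) (e : nat -> num M) (t : term) : num M :=
  match t with
  | Var n => e n
  | Zero => zero M
  | One => one M
  | Add s t => add M (eval M e s) (eval M e t)
  | Mul s t => mul M (eval M e s) (eval M e t)
  end.

(** Henkin semantics: set quantifiers range over the set sort of [M], which may omit subsets of the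
    numbers. Equality is true identity, which forces a quotient in the term model. *)
Fixpoint sat (M : structure) (e : nat -> num M) (v : nat -> set M) (A : form) : Prop :=
  match A with
  | Bot => False
  | Eq s t => eval M e s = eval M e t
  | Lt s t => lt M (eval M e s) (eval M e t)
  | In t X => mem M (eval M e t) (v X)
  | And A B => sat M e v A /\ sat M e v B
  | Or A B => sat M e v A \/ sat M e v B
  | Imp A B => sat M e v A -> sat M e v B
  | AllN A => forall x, sat M (scons x e) v A
  | ExN A => exists x, sat M (scons x e) v A
  | AllS A => forall X, sat M e (scons X v) A
  | ExS A => exists X, sat M e (scons X v) A
  end.

(** * The maximal consistent Henkin theory *)

Section Completeness.

Variable T : form -> Prop.
Notation "Gamma |- A" := (proves T Gamma A) (at level 68).

Lemma prBotE Gamma A : Gamma |- Bot -> Gamma |- A.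
Proof.
intros H; apply prRaa; eapply weakening; [exact H|apply incl_tl, incl_refl].
Qed.

Lemma prNotAllN Gamma A : Gamma |- Not (AllN A) -> Gamma |- ExN (Not A).
Proof.
intros H; apply prRaa; eapply prImpE.
{ eapply weakening; [exact H|apply incl_tl, incl_refl]. }
apply prAllNI, prRaa; eapply prImpE.
{ apply prHyp; right; cbn; left; reflexivity. }
apply (prExNI _ _ _ (Var 0)).
match goal with |- proves _ ?G _ =>
  change (G |- instN (Var 0) (subst (upN (fun n => Var (S n))) (fun X => X) (Not A)))
end.
rewrite instN_upN.
replace (scons (Var 0) (fun n => Var (S n))) with Var.
2:{ apply functional_extensionality; intros [|n]; reflexivity. }
rewrite subst_id; apply prHyp; now left.
Qed.

Lemma prNotAllS Gamma A : Gamma |- Not (AllS A) -> Gamma |- ExS (Not A).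
Proof.
intros H; apply prRaa; eapply prImpE.
{ eapply weakening; [exact H|apply incl_tl, incl_refl]. }
apply prAllSI, prRaa; eapply prImpE.
{ apply prHyp; right; cbn; left; reflexivity. }
apply (prExSI _ _ _ 0).
match goal with |- proves _ ?G _ =>
  change (G |- instS 0 (subst Var (upS S) (Not A)))
end.
rewrite instS_upS.
replace (scons 0 S) with (fun X : nat => X).
2:{ apply functional_extensionality; intros [|n]; reflexivity. }
rewrite subst_id; apply prHyp; now left.
Qed.

Variable Gamma0 : list form.
Hypothesis consistent0 : consistent T Gamma0.

Lemma henkin_chain : exists G : nat -> list form, G 0 = Gamma0 /\
  forall n, consistent T (G n) /\ incl (G n) (G (S n)) /\
    (consistent T (form_enum n :: G n) -> List.In (form_enum n) (G (S n)) /\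
      (forall B, form_enum n = ExN B -> exists t, List.In (instN t B) (G (S n))) /\
      (forall B, form_enum n = ExS B -> exists X, List.In (instS X B) (G (S n)))).
Proof.
pose (next (n : nat) (G : {Gamma | consistent T Gamma}) :=
  let (D, HD) := constructive_indefinite_description _
    (henkin_step T (proj1_sig G) (form_enum n) (proj2_sig G)) in
  exist (consistent T) D (proj1 HD)).
pose (G := fix G n := match n with
  | O => exist (consistent T) Gamma0 consistent0
  | S n => next n (G n) end).
exists (fun n => proj1_sig (G n)); split; [reflexivity|]; intros n.
split; [apply proj2_sig|].
change (G (S n)) with (next n (G n)); unfold next.
destruct constructive_indefinite_description as [D [HD1 HD2]]; exact HD2.
Qed.

Definition henkin_seq := proj1_sig (constructive_indefinite_description _ henkin_chain).

Definition theory (A : form) : Prop := exists n, henkin_seq n |- A.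

Lemma henkin_seq_mono n m : n <= m -> incl (henkin_seq n) (henkin_seq m).
Proof.
unfold henkin_seq; destruct constructive_indefinite_description as [G [H0 HG]]; cbn.
induction 1; [apply incl_refl|].
eapply incl_tran; [exact IHle|apply HG].
Qed.

Lemma theory_0 A : List.In A Gamma0 -> theory A.
Proof.
intros HA; exists 0; apply prHyp; unfold henkin_seq.
destruct constructive_indefinite_description as [G [H0 HG]]; cbn; now rewrite H0.
Qed.

Lemma theory_consistent : ~ theory Bot.
Proof.
intros [n Hn]; revert Hn; unfold henkin_seq.
destruct constructive_indefinite_description as [G [H0 HG]]; cbn; apply HG.
Qed.

Lemma theory_seq A n : theory A -> exists m, n <= m /\ henkin_seq m |- A.
Proof.
intros [k Hk]; exists (n + k); split; [lia|].
eapply weakening; [exact Hk|apply henkin_seq_mono; lia].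
Qed.

Lemma theory_rule0 A : (forall Gamma, Gamma |- A) -> theory A.
Proof. intros H; exists 0; apply H. Qed.

Lemma theory_rule1 A B : (forall Gamma, Gamma |- A -> Gamma |- B) ->
  theory A -> theory B.
Proof. intros H [n Hn]; exists n; auto. Qed.

(** The premises may appear at different stages, but the contexts increase, so both hold at the
    later one. *)
Lemma theory_rule2 A B C : (forall Gamma, Gamma |- A -> Gamma |- B -> Gamma |- C) ->
  theory A -> theory B -> theory C.
Proof.
intros H [n Hn] HB; destruct (theory_seq B n HB) as [m [Hm HmB]].
exists m; apply H; [|assumption].
eapply weakening; [exact Hn|now apply henkin_seq_mono].
Qed.

Lemma theory_cases A : theory A \/ theory (Not A).
Proof.
destruct (form_enum_surj A) as [n <-].
unfold theory, henkin_seq.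
destruct constructive_indefinite_description as [G [H0 HG]]; cbn.
destruct (classic (consistent T (form_enum n :: G n))) as [HC|HC].
- left; exists (S n); apply prHyp, (proj2 (proj2 (HG n)) HC).
- right; exists n; apply prImpI; now apply NNPP.
Qed.

Lemma theory_not A : theory (Not A) <-> ~ theory A.
Proof.
split.
- intros H1 H2; apply theory_consistent; revert H1 H2; apply theory_rule2.
  intros; eapply prImpE; eauto.
- destruct (theory_cases A); tauto.
Qed.

(** Leads from derivability at an arbitrary stage back to the stage [n] that treats [A], where its
    witness was added. If [A] were refuted there, a later context would prove both [A] and its
    negation. *)
Lemma theory_in_step A n : form_enum n = A -> theory A ->
  consistent T (A :: henkin_seq n).
Proof.
intros <- HA HB; apply theory_consistent.
destruct (theory_seq _ n HA) as [m [Hm HmA]]; exists m.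
eapply prImpE; [|exact HmA]; apply prImpI; eapply weakening; [exact HB|].
apply incl_cons; [now left|]; apply incl_tl; now apply henkin_seq_mono.
Qed.

Lemma theory_ExN A : theory (ExN A) <-> exists t, theory (instN t A).
Proof.
split.
- intros H; destruct (form_enum_surj (ExN A)) as [n Hn].
  assert (HC := theory_in_step _ _ Hn H); revert HC; unfold theory, henkin_seq.
  destruct constructive_indefinite_description as [G [H0 HG]]; cbn.
  rewrite <- Hn; intros HC; destruct (proj2 (proj2 (HG n)) HC) as [_ [HE _]].
  destruct (HE A Hn) as [t Ht]; exists t, (S n); now apply prHyp.
- intros [t Ht]; revert Ht; apply theory_rule1; intros; now apply prExNI with t.
Qed.

Lemma theory_ExS A : theory (ExS A) <-> exists X, theory (instS X A).
Proof.
split.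
- intros H; destruct (form_enum_surj (ExS A)) as [n Hn].
  assert (HC := theory_in_step _ _ Hn H); revert HC; unfold theory, henkin_seq.
  destruct constructive_indefinite_description as [G [H0 HG]]; cbn.
  rewrite <- Hn; intros HC; destruct (proj2 (proj2 (HG n)) HC) as [_ [_ HE]].
  destruct (HE A Hn) as [t Ht]; exists t, (S n); now apply prHyp.
- intros [t Ht]; revert Ht; apply theory_rule1; intros; now apply prExSI with t.
Qed.

Lemma theory_AllN A : theory (AllN A) <-> forall t, theory (instN t A).
Proof.
split.
- intros H t; revert H; apply theory_rule1; intros; now apply prAllNE.
- intros H; destruct (theory_cases (AllN A)) as [|HN]; [assumption|exfalso].
  assert (HE : theory (ExN (Not A))).
  { revert HN; apply theory_rule1; intros; now apply prNotAllN. }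
  apply theory_ExN in HE; destruct HE as [t Ht].
  apply (proj1 (theory_not (instN t A))); [exact Ht|apply H].
Qed.

Lemma theory_AllS A : theory (AllS A) <-> forall X, theory (instS X A).
Proof.
split.
- intros H t; revert H; apply theory_rule1; intros; now apply prAllSE.
- intros H; destruct (theory_cases (AllS A)) as [|HN]; [assumption|exfalso].
  assert (HE : theory (ExS (Not A))).
  { revert HN; apply theory_rule1; intros; now apply prNotAllS. }
  apply theory_ExS in HE; destruct HE as [t Ht].
  apply (proj1 (theory_not (instS t A))); [exact Ht|apply H].
Qed.

Lemma theory_And A B : theory (And A B) <-> theory A /\ theory B.
Proof.
split; [intros H; split; revert H; apply theory_rule1|].
- intros; eapply prAndE1; eauto.
- intros; eapply prAndE2; eauto.
- intros [HA HB]; revert HA HB; apply theory_rule2; intros; now apply prAndI.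
Qed.

Lemma theory_Imp A B : theory (Imp A B) <-> (theory A -> theory B).
Proof.
split.
- apply theory_rule2; intros; eapply prImpE; eauto.
- intros H; destruct (theory_cases A) as [HA|HA].
  + generalize (H HA); apply theory_rule1; intros G HG; apply prImpI.
    eapply weakening; [exact HG|apply incl_tl, incl_refl].
  + revert HA; apply theory_rule1; intros G HG; apply prImpI, prBotE.
    eapply prImpE; [|apply prHyp; now left].
    eapply weakening; [exact HG|apply incl_tl, incl_refl].
Qed.

Lemma theory_Or A B : theory (Or A B) <-> theory A \/ theory B.
Proof.
split.
- intros H; destruct (theory_cases A) as [|HA]; [now left|right].
  revert H HA; apply theory_rule2; intros G H1 H2.
  eapply prOrE; [exact H1| |apply prHyp; now left].
  apply prBotE; eapply prImpE; [|apply prHyp; now left].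
  eapply weakening; [exact H2|apply incl_tl, incl_refl].
- intros [H|H]; revert H; apply theory_rule1; intros; [now apply prOrI1|now apply prOrI2].
Qed.

(** * The term model modulo provable equality *)

Lemma theory_leibniz s t A :
  theory (Eq s t) -> theory (instN s A) -> theory (instN t A).
Proof. apply theory_rule2; intros; eapply prEqE; eauto. Qed.

Lemma instN_lift_term s t : subst_term (scons s Var) (lift_term t) = t.
Proof. unfold lift_term; rewrite subst_term_comp; apply subst_term_Var. Qed.

Lemma theory_refl t : theory (Eq t t).
Proof. apply theory_rule0; intros; apply prEqI. Qed.

Lemma theory_sym s t : theory (Eq s t) -> theory (Eq t s).
Proof.
intros H; generalize (theory_leibniz s t (Eq (Var 0) (lift_term s)) H).
cbn; rewrite !instN_lift_term; intros H1; apply H1, theory_refl.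
Qed.

Lemma theory_trans s t u : theory (Eq s t) -> theory (Eq t u) -> theory (Eq s u).
Proof.
intros H1 H2; generalize (theory_leibniz t u (Eq (lift_term s) (Var 0)) H2).
cbn; rewrite !instN_lift_term; auto.
Qed.

Lemma theory_term s t u : theory (Eq s t) ->
  theory (Eq (subst_term (scons s Var) u) (subst_term (scons t Var) u)).
Proof.
intros H; generalize (theory_leibniz s t
  (Eq (lift_term (subst_term (scons s Var) u)) u) H).
cbn; rewrite !instN_lift_term; intros H1; apply H1, theory_refl.
Qed.

Lemma theory_cong2 op s s' t t' : (op = Add \/ op = Mul) ->
  theory (Eq s s') -> theory (Eq t t') -> theory (Eq (op s t) (op s' t')).
Proof.
intros Hop H1 H2; apply theory_trans with (op s' t).
- generalize (theory_term s s' (op (Var 0) (lift_term t)) H1).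
  destruct Hop as [->| ->]; cbn; rewrite !instN_lift_term; auto.
- generalize (theory_term t t' (op (lift_term s') (Var 0)) H2).
  destruct Hop as [->| ->]; cbn; rewrite !instN_lift_term; auto.
Qed.

Lemma theory_Lt s s' t t' : theory (Eq s s') -> theory (Eq t t') ->
  theory (Lt s t) -> theory (Lt s' t').
Proof.
intros H1 H2 H3.
generalize (theory_leibniz s s' (Lt (Var 0) (lift_term t)) H1).
generalize (theory_leibniz t t' (Lt (lift_term s') (Var 0)) H2).
cbn; rewrite !instN_lift_term; auto.
Qed.

(** Provably equal terms give extensionally equal predicates, for which [epsilon] picks the same
    term. So the fixed points of [canon] represent the quotient, and equality of classes is
    identity. *)
Definition canon (t : term) : term :=
  epsilon (inhabits Zero) (fun s => theory (Eq s t)).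

Lemma canon_eq t : theory (Eq (canon t) t).
Proof.
apply (epsilon_spec (inhabits Zero) (fun s => theory (Eq s t))).
exists t; apply theory_refl.
Qed.

Lemma canon_iff s t : canon s = canon t <-> theory (Eq s t).
Proof.
split.
- intros H; apply theory_trans with (canon s); [apply theory_sym, canon_eq|].
  rewrite H; apply canon_eq.
- intros H; unfold canon; f_equal; apply functional_extensionality; intros u.
  apply propositional_extensionality; split; intros Hu.
  + now apply theory_trans with s.
  + apply theory_trans with t; [assumption|now apply theory_sym].
Qed.

Definition class : Type := {t : term | canon t = t}.

Definition cls (t : term) : class :=
  exist _ (canon t) (proj2 (canon_iff _ _) (canon_eq t)).

Definition repr (x : class) : term := proj1_sig x.

Lemma class_eq (x y : class) : repr x = repr y -> x = y.
Proof. apply eq_sig_hprop; intros; apply proof_irrelevance. Qed.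

Lemma cls_iff s t : cls s = cls t <-> theory (Eq s t).
Proof.
rewrite <- canon_iff; split; [intros [=]; assumption|].
intros H; apply class_eq; exact H.
Qed.

Lemma cls_repr x : cls (repr x) = x.
Proof. destruct x as [t Ht]; apply class_eq; exact Ht. Qed.

Lemma repr_cls t : theory (Eq (repr (cls t)) t).
Proof. apply canon_eq. Qed.

(** Set terms are only variables and carry no equality, so the indices themselves serve as sets. *)
Definition term_model : structure := {|
  num := class;
  set := nat;
  zero := cls Zero;
  one := cls One;
  add x y := cls (Add (repr x) (repr y));
  mul x y := cls (Mul (repr x) (repr y));
  lt x y := theory (Lt (repr x) (repr y));
  mem x X := theory (In (repr x) X)
|}.

Lemma eval_term_model sigma t :
  eval term_model (fun n => cls (sigma n)) t = cls (subst_term sigma t).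
Proof.
induction t; cbn; try reflexivity; rewrite IHt1, IHt2; apply cls_iff;
  apply theory_cong2; auto using repr_cls.
Qed.

Lemma cls_scons x sigma :
  scons x (fun n => cls (sigma n)) = (fun n => cls (scons (repr x) sigma n)).
Proof.
apply functional_extensionality; intros [|n]; cbn; [now rewrite cls_repr|reflexivity].
Qed.

Lemma cls_scons_cls t sigma :
  scons (cls t) (fun n => cls (sigma n)) = (fun n => cls (scons t sigma n)).
Proof. apply functional_extensionality; intros [|n]; reflexivity. Qed.

(** Stated for all substitution instances because a quantifier extends [sigma] or [rho] by a
    witness; every number of the model is the class of a term, so instances by terms cover the whole
    domain. *)
Lemma truth A : forall sigma rho,
  sat term_model (fun n => cls (sigma n)) rho A <-> theory (subst sigma rho A).
Proof.
induction A; intros; cbn [sat subst].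
- split; [tauto|apply theory_consistent].
- rewrite !eval_term_model; apply cls_iff.
- rewrite !eval_term_model; cbn; split; apply theory_Lt;
    auto using canon_eq, theory_sym.
- rewrite !eval_term_model; cbn.
  pose proof (theory_leibniz (repr (cls (subst_term sigma t))) (subst_term sigma t)
    (In (Var 0) (rho X)) (repr_cls _)) as H1.
  pose proof (theory_leibniz (subst_term sigma t) (repr (cls (subst_term sigma t)))
    (In (Var 0) (rho X)) (theory_sym _ _ (repr_cls _))) as H2.
  split; [exact H1|exact H2].
- rewrite IHA1, IHA2; symmetry; apply theory_And.
- rewrite IHA1, IHA2; symmetry; apply theory_Or.
- rewrite IHA1, IHA2; symmetry; apply theory_Imp.
- rewrite theory_AllN; split.
  + intros H t; rewrite instN_upN; apply IHA.
    rewrite <- cls_scons_cls; apply H.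
  + intros H x; rewrite cls_scons, IHA, <- instN_upN; apply H.
- rewrite theory_ExN; split.
  + intros [x Hx]; exists (repr x); rewrite instN_upN, <- IHA, <- cls_scons; exact Hx.
  + intros [t Ht]; exists (cls t).
    rewrite instN_upN, <- IHA, <- cls_scons_cls in Ht; exact Ht.
- rewrite theory_AllS; split.
  + intros H X; rewrite instS_upS; apply IHA, H.
  + intros H X; apply IHA; rewrite <- instS_upS; apply H.
- rewrite theory_ExS; split; intros [X HX]; exists X.
  + rewrite instS_upS; now apply IHA.
  + apply IHA; now rewrite <- instS_upS.
Qed.

End Completeness.

(** If [B] is unprovable, then [Not B] is consistent and its term model refutes [B]. The axioms hold
    there under every environment, since an environment amounts to a substitution by representatives
    and [axiom_subst] derives all instances. *)
Theorem completeness (T : form -> Prop) (B : form) :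
  (forall M, (forall A, T A -> forall e v, sat M e v A) -> forall e v, sat M e v B) ->
  provable T B.
Proof.
intros H; apply NNPP; intros HB.
assert (HC : consistent T [Not B]).
{ intros HC; apply HB; now apply prRaa. }
pose (M := term_model T _ HC).
assert (HM : forall A e v, sat M e v A <-> theory T _ HC (subst (fun n => repr T _ HC (e n)) v A)).
{ intros A e v; rewrite <- truth.
  replace (fun n => cls T _ HC (repr T _ HC (e n))) with e; [reflexivity|].
  apply functional_extensionality; intros n; symmetry; apply cls_repr. }
assert (HBs : sat M (fun n => cls T _ HC (Var n)) (fun X => X) B).
{ apply H; intros A HA e v; apply HM, theory_rule0; intros Gamma.
  now apply axiom_subst. }
apply (truth T _ HC) in HBs; rewrite subst_id in HBs.
revert HBs; apply theory_not, theory_0; now left.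
Qed.

(** * Substitution and satisfaction *)

Lemma eval_subst M e sigma t :
  eval M e (subst_term sigma t) = eval M (fun n => eval M e (sigma n)) t.
Proof. induction t; cbn; congruence. Qed.

Lemma sat_subst M A : forall e v sigma rho,
  sat M e v (subst sigma rho A) <->
  sat M (fun n => eval M e (sigma n)) (fun X => v (rho X)) A.
Proof.
assert (HN : forall e x sigma, (fun n => eval M (scons x e) (upN sigma n)) =
  scons x (fun n => eval M e (sigma n))).
{ intros; apply functional_extensionality; intros [|n]; [reflexivity|].
  cbn; unfold lift_term; now rewrite eval_subst. }
assert (HS : forall (v : nat -> set M) X rho, (fun Y => scons X v (upS rho Y)) =
  scons X (fun Y => v (rho Y))).
{ intros; apply functional_extensionality; intros [|n]; reflexivity. }
induction A; intros; cbn; rewrite ?eval_subst; try tauto.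
- rewrite IHA1, IHA2; tauto.
- rewrite IHA1, IHA2; tauto.
- rewrite IHA1, IHA2; tauto.
- split; intros H x; specialize (H x); rewrite IHA, HN in *; exact H.
- split; intros [x H]; exists x; rewrite IHA, HN in *; exact H.
- split; intros H x; specialize (H x); rewrite IHA, HS in *; exact H.
- split; intros [x H]; exists x; rewrite IHA, HS in *; exact H.
Qed.

Lemma delta00_subst A : delta00 A -> forall sigma rho, delta00 (subst sigma rho A).
Proof.
assert (HL : forall sigma t,
  subst_term (upN sigma) (lift_term t) = lift_term (subst_term sigma t)).
{ intros; unfold lift_term; now rewrite !subst_term_comp. }
induction 1; intros; cbn; rewrite ?HL; constructor; auto.
Qed.

(** * Definability and arithmetic in models of RCA_0 *)

Declare Scope model_scope.

Section Models.

Variable M : structure.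
Variable v0 : nat -> set M.

(** The even variables are those of the environment, the odd ones hold
    parameters. *)
Fixpoint split_var (n : nat) : nat + nat :=
  match n with
  | 0 => inl 0
  | 1 => inr 0
  | S (S n) => match split_var n with inl i => inl (S i) | inr i => inr (S i) end
  end.

Lemma split_var_l i : split_var (2 * i) = inl i.
Proof.
induction i; [reflexivity|].
replace (2 * S i) with (S (S (2 * i))) by lia; cbn [split_var]; now rewrite IHi.
Qed.

Lemma split_var_r i : split_var (S (2 * i)) = inr i.
Proof.
induction i; [reflexivity|].
replace (S (2 * S i)) with (S (S (S (2 * i)))) by lia; cbn [split_var].
cbn [split_var] in IHi; now rewrite IHi.
Qed.

Definition merge {T : Type} (a b : nat -> T) (n : nat) : T :=
  match split_var n with inl i => a i | inr i => b i end.

Lemma merge_l T (a b : nat -> T) i : merge a b (2 * i) = a i.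
Proof. unfold merge; now rewrite split_var_l. Qed.

Lemma merge_r T (a b : nat -> T) i : merge a b (S (2 * i)) = b i.
Proof. unfold merge; now rewrite split_var_r. Qed.

(** * Predicates definable by bounded formulas *)

Definition defines (phi : (nat -> num M) -> Prop) A (v : nat -> set M) c : Prop :=
  delta00 A /\ forall e, phi e <-> sat M (merge e c) v A.

(** Definability is treated semantically, as a property of predicates on environments. The closure
    lemmas then follow the shape of a Rocq proposition, so that concrete formulas of the object
    language rarely have to be written. *)
Definition D0 (phi : (nat -> num M) -> Prop) : Prop :=
  exists A v c, defines phi A v c.

Definition T0 (tau : (nat -> num M) -> num M) : Prop :=
  exists t c, forall e, tau e = eval M (merge e c) t.

Definition reparam (f : nat -> nat) (n : nat) : nat :=
  match split_var n with inl i => 2 * i | inr i => S (2 * f i) end.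

Lemma merge_reparam T (e c : nat -> T) f :
  (fun n => merge e c (reparam f n)) = merge e (fun i => c (f i)).
Proof.
apply functional_extensionality; intros n; unfold reparam, merge at 2.
destruct (split_var n); [apply merge_l|apply merge_r].
Qed.

Lemma merge_l_fun T (a b : nat -> T) : (fun i => merge a b (2 * i)) = a.
Proof. apply functional_extensionality; intros; apply merge_l. Qed.

Lemma merge_r_fun T (a b : nat -> T) : (fun i => merge a b (S (2 * i))) = b.
Proof. apply functional_extensionality; intros; apply merge_r. Qed.

Lemma defines_reparam phi A f g v c :
  defines phi A (fun i => v (g i)) (fun i => c (f i)) ->
  defines phi (subst (fun n => Var (reparam f n)) g A) v c.
Proof.
intros [HA H]; split; [now apply delta00_subst|].
intros e; rewrite sat_subst, H; cbn; now rewrite merge_reparam.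
Qed.

(** Interleaving the two lists of parameters, even places for [phi] and odd ones for [psi], makes a
    common list. *)
Lemma defines_common phi psi : D0 phi -> D0 psi ->
  exists A B v c, defines phi A v c /\ defines psi B v c.
Proof.
intros (A & v & c & HA) (B & w & d & HB).
do 2 eexists; exists (merge v w), (merge c d); split.
- apply (defines_reparam _ A (fun i => 2 * i) (fun i => 2 * i)).
  rewrite !merge_l_fun; exact HA.
- apply (defines_reparam _ B (fun i => S (2 * i)) (fun i => S (2 * i))).
  rewrite !merge_r_fun; exact HB.
Qed.

Lemma T0_reparam tau t f c :
  (forall e, tau e = eval M (merge e (fun i => c (f i))) t) ->
  forall e, tau e = eval M (merge e c) (subst_term (fun n => Var (reparam f n)) t).
Proof. intros H e; rewrite eval_subst, H; cbn; now rewrite merge_reparam. Qed.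

Lemma T0_common tau tau' : T0 tau -> T0 tau' -> exists t t' c,
  (forall e, tau e = eval M (merge e c) t) /\
  (forall e, tau' e = eval M (merge e c) t').
Proof.
intros (t & c & Ht) (t' & c' & Ht'); do 2 eexists; exists (merge c c'); split.
- apply (T0_reparam _ t (fun i => 2 * i)); now rewrite merge_l_fun.
- apply (T0_reparam _ t' (fun i => S (2 * i))); now rewrite merge_r_fun.
Qed.

Lemma defines_T0_common phi tau : D0 phi -> T0 tau -> exists A t v c,
  defines phi A v c /\ forall e, tau e = eval M (merge e c) t.
Proof.
intros (A & v & c & HA) (t & d & Ht); do 2 eexists; exists v, (merge c d); split.
- apply (defines_reparam _ A (fun i => 2 * i) (fun i => i)).
  rewrite merge_l_fun; exact HA.
- apply (T0_reparam _ t (fun i => S (2 * i))); now rewrite merge_r_fun.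
Qed.

Lemma T0_var i : T0 (fun e => e i).
Proof. exists (Var (2 * i)), (fun _ => zero M); intros; cbn [eval]; now rewrite merge_l. Qed.

Lemma T0_const c : T0 (fun _ => c).
Proof. exists (Var 1), (fun _ => c); reflexivity. Qed.

Lemma T0_rename tau (f : nat -> nat) : T0 tau -> T0 (fun e => tau (fun n => e (f n))).
Proof.
intros (t & c & H).
exists (subst_term (fun n => Var match split_var n with
  inl i => 2 * f i | inr i => S (2 * i) end) t), c; intros e.
rewrite eval_subst, H; f_equal; apply functional_extensionality; intros n; cbn [eval].
unfold merge at 1; destruct (split_var n); symmetry; [apply merge_l|apply merge_r].
Qed.

Lemma T0_add t1 t2 : T0 t1 -> T0 t2 -> T0 (fun e => add M (t1 e) (t2 e)).
Proof.
intros H1 H2; destruct (T0_common _ _ H1 H2) as (a & b & c & Ha & Hb).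
exists (Add a b), c; intros; cbn; now rewrite Ha, Hb.
Qed.

Lemma T0_mul t1 t2 : T0 t1 -> T0 t2 -> T0 (fun e => mul M (t1 e) (t2 e)).
Proof.
intros H1 H2; destruct (T0_common _ _ H1 H2) as (a & b & c & Ha & Hb).
exists (Mul a b), c; intros; cbn; now rewrite Ha, Hb.
Qed.

Lemma D0_eq t1 t2 : T0 t1 -> T0 t2 -> D0 (fun e => t1 e = t2 e).
Proof.
intros H1 H2; destruct (T0_common _ _ H1 H2) as (a & b & c & Ha & Hb).
exists (Eq a b), v0, c; split; [constructor|intros; cbn; now rewrite Ha, Hb].
Qed.

Lemma D0_lt t1 t2 : T0 t1 -> T0 t2 -> D0 (fun e => lt M (t1 e) (t2 e)).
Proof.
intros H1 H2; destruct (T0_common _ _ H1 H2) as (a & b & c & Ha & Hb).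
exists (Lt a b), v0, c; split; [constructor|intros; cbn; now rewrite Ha, Hb].
Qed.

Lemma D0_mem t1 X : T0 t1 -> D0 (fun e => mem M (t1 e) X).
Proof.
intros (t & c & Ht); exists (In t 0), (fun _ => X), c.
split; [constructor|intros; cbn; now rewrite Ht].
Qed.

Lemma D0_False : D0 (fun _ => False).
Proof. exists Bot, v0, (fun _ => zero M); split; [constructor|reflexivity]. Qed.

Lemma D0_and phi psi : D0 phi -> D0 psi -> D0 (fun e => phi e /\ psi e).
Proof.
intros H1 H2; destruct (defines_common _ _ H1 H2) as (A & B & v & c & [HA H3] & [HB H4]).
exists (And A B), v, c; split; [now constructor|intros; cbn; now rewrite H3, H4].
Qed.

Lemma D0_or phi psi : D0 phi -> D0 psi -> D0 (fun e => phi e \/ psi e).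
Proof.
intros H1 H2; destruct (defines_common _ _ H1 H2) as (A & B & v & c & [HA H3] & [HB H4]).
exists (Or A B), v, c; split; [now constructor|intros; cbn; now rewrite H3, H4].
Qed.

Lemma D0_imp phi psi : D0 phi -> D0 psi -> D0 (fun e => phi e -> psi e).
Proof.
intros H1 H2; destruct (defines_common _ _ H1 H2) as (A & B & v & c & [HA H3] & [HB H4]).
exists (Imp A B), v, c; split; [now constructor|intros; cbn; now rewrite H3, H4].
Qed.

Lemma D0_not phi : D0 phi -> D0 (fun e => ~ phi e).
Proof. intros H; apply D0_imp; [exact H|apply D0_False]. Qed.

(** A quantifier puts its variable in front of the merged environment, whereas [merge (scons x e) c]
    has it as the first of the even variables; this renaming passes between the two layouts. *)
Definition shift_var (n : nat) : nat :=
  match split_var n with inl 0 => 0 | inl (S i) => S (2 * i) | inr i => S (S (2 * i)) end.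

Lemma merge_shift T x (e c : nat -> T) :
  (fun n => scons x (merge e c) (shift_var n)) = merge (scons x e) c.
Proof.
apply functional_extensionality; intros n; unfold shift_var, merge at 2.
destruct (split_var n) as [[|i]|i];
  [reflexivity|exact (merge_l T e c i)|exact (merge_r T e c i)].
Qed.

Lemma eval_lift x e t : eval M (scons x e) (lift_term t) = eval M e t.
Proof. unfold lift_term; now rewrite eval_subst. Qed.

Lemma D0_all tau (Q : (nat -> num M) -> num M -> Prop) :
  T0 tau -> D0 (fun e => Q (fun n => e (S n)) (e 0)) ->
  D0 (fun e => forall x, lt M x (tau e) -> Q e x).
Proof.
intros H1 H2; destruct (defines_T0_common _ _ H2 H1) as (A & t & v & c & [HA H3] & H4).
exists (AllN (Imp (Lt (Var 0) (lift_term t))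
  (subst (fun n => Var (shift_var n)) (fun X => X) A))), v, c.
split; [constructor; now apply delta00_subst|].
intros e; cbn [sat]; split; intros H x; specialize (H x);
  specialize (H3 (scons x e)); cbn in *;
  rewrite eval_lift, sat_subst, H4 in *; cbn in *; rewrite merge_shift in *;
  intros Hx; [apply H3, H, Hx|apply H, H3 in Hx; exact Hx].
Qed.

Lemma D0_ex tau (Q : (nat -> num M) -> num M -> Prop) :
  T0 tau -> D0 (fun e => Q (fun n => e (S n)) (e 0)) ->
  D0 (fun e => exists x, lt M x (tau e) /\ Q e x).
Proof.
intros H1 H2; destruct (defines_T0_common _ _ H2 H1) as (A & t & v & c & [HA H3] & H4).
exists (ExN (And (Lt (Var 0) (lift_term t))
  (subst (fun n => Var (shift_var n)) (fun X => X) A))), v, c.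
split; [constructor; now apply delta00_subst|].
intros e; cbn [sat]; split; intros [x H]; exists x;
  specialize (H3 (scons x e)); cbn in *;
  rewrite eval_lift, sat_subst, H4 in *; cbn in *; rewrite merge_shift in *;
  (split; [apply H|apply H3, H]).
Qed.

Ltac t0 :=
  solve [repeat first
    [ match goal with H : T0 ?tau |- _ => first
        [ exact H
        | exact (T0_rename tau S H)
        | exact (T0_rename tau (fun n => S (S n)) H)
        | exact (T0_rename tau (fun n => S (S (S n))) H)
        | exact (T0_rename tau (fun n => S (S (S (S n)))) H)
        | exact (T0_rename tau (fun n => S (S (S (S (S n))))) H) ] end
    | apply T0_const | apply T0_var | apply T0_add | apply T0_mul ]].

Ltac d0_step :=
  first [ apply D0_all; [t0|] | apply D0_ex; [t0|]
        | apply D0_and | apply D0_or | apply D0_not | apply D0_imp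
        | apply D0_False | apply D0_eq; t0 | apply D0_lt; t0 | apply D0_mem; t0 ];
  try assumption; cbv beta.

Ltac d0 := cbv beta; repeat d0_step.

(** * Induction and comprehension for definable predicates *)

Hypothesis RCA : forall A, RCA0 A -> forall e v, sat M e v A.

Notation N := (num M).
Notation "0" := (zero M) : model_scope.
Notation "1" := (one M) : model_scope.
Notation "x + y" := (add M x y) : model_scope.
Notation "x * y" := (mul M x y) : model_scope.
Notation "x < y" := (lt M x y) : model_scope.
Notation "x \in X" := (mem M x X) : model_scope.
Local Open Scope model_scope.

(** Closing over all argument terms makes [Q] usable as an atom under further bounded
    quantifiers. *)
Definition D2 (Q : N -> N -> Prop) : Prop :=
  forall tau sigma, T0 tau -> T0 sigma -> D0 (fun e => Q (tau e) (sigma e)).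

(** A bounded formula becomes a [sigma01] one by a vacuous existential quantifier, witnessed by [0];
    the extra [S] in the renaming skips its variable. For comprehension the same matrix also gets a
    vacuous universal quantifier. *)
Lemma D0_induction (P : N -> Prop) : D0 (fun e => P (e O)) ->
  P 0 -> (forall x, P x -> P (x + 1)) -> forall x, P x.
Proof.
intros (A & v & c & HA & H) H0 HS x.
set (B := subst (fun n => Var (S (shift_var n))) (fun X => X) A).
assert (HB : sigma01 (ExN B)).
{ constructor; now apply delta00_subst. }
assert (E : forall x e, sat M (scons x (merge e c)) v (ExN B) <-> P x).
{ intros y e; unfold B; cbn [sat]; split.
  - intros [z Hz]; rewrite sat_subst in Hz; cbn in Hz.
    rewrite merge_shift in Hz; now apply H in Hz.
  - intros Hy; exists 0; rewrite sat_subst; cbn; rewrite merge_shift; now apply H. }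
pose (e0 := fun _ : nat => 0).
apply (E x e0); apply (RCA _ (axInduction _ HB) (merge e0 c) v); split.
- unfold instN; apply sat_subst.
  replace (fun n => eval M _ _) with (scons 0 (merge e0 c)); [now apply E|].
  apply functional_extensionality; intros [|n]; reflexivity.
- intros y Hy; apply sat_subst.
  replace (fun n => eval M _ _) with (scons (y + 1) (merge e0 c)).
  + apply E, HS; now apply E in Hy.
  + apply functional_extensionality; intros [|n]; reflexivity.
Qed.

Lemma D0_comprehension (P : N -> Prop) : D0 (fun e => P (e O)) ->
  exists X, forall x, x \in X <-> P x.
Proof.
intros (A & v & c & HA & H).
set (B := subst (fun n => Var (S (shift_var n))) (fun X => X) A).
assert (HB : sigma01 (ExN B)).
{ constructor; now apply delta00_subst. }
assert (HB' : pi01 (AllN B)).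
{ constructor; now apply delta00_subst. }
pose (e0 := fun _ : nat => 0).
assert (E : forall x z, sat M (scons z (scons x (merge e0 c))) v B <-> P x).
{ intros y z; unfold B; rewrite sat_subst; cbn; rewrite merge_shift.
  symmetry; apply (H (scons y e0)). }
destruct (RCA _ (axComprehension _ _ HB HB') (merge e0 c) v) as [X HX].
{ intros x; split; cbn [sat].
  - intros [z Hz] w; apply E in Hz; now apply E.
  - intros Hw; exists 0; apply E; apply (E x 0), Hw. }
exists X; intros x; destruct (HX x) as [H1 H2]; unfold liftS in H1, H2.
rewrite sat_subst in H1, H2; cbn [sat] in H1, H2; split.
- intros Hx; destruct (H1 Hx) as [z Hz]; now apply E in Hz.
- intros Hx; apply H2; exists 0; now apply E.
Qed.

(** * Arithmetic in the model *)

Lemma succ_neq_0 x : x + 1 <> 0.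
Proof. exact (RCA _ axSuccNeqZero (fun _ => x) v0). Qed.

Lemma add_0_r x : x + 0 = x.
Proof. exact (RCA _ axAddZero (fun _ => x) v0). Qed.

Lemma add_succ_r x y : x + (y + 1) = (x + y) + 1.
Proof. exact (RCA _ axAddSucc (scons y (fun _ => x)) v0). Qed.

Lemma mul_0_r x : x * 0 = 0.
Proof. exact (RCA _ axMulZero (fun _ => x) v0). Qed.

Lemma mul_succ_r x y : x * (y + 1) = x * y + x.
Proof. exact (RCA _ axMulSucc (scons y (fun _ => x)) v0). Qed.

Lemma nlt_0 x : ~ x < 0.
Proof. exact (RCA _ axLtZero (fun _ => x) v0). Qed.

Lemma lt_succ x y : x < y + 1 <-> x < y \/ x = y.
Proof. exact (RCA _ axLtSucc (scons y (fun _ => x)) v0). Qed.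

Ltac induct x := pattern x; revert x; apply D0_induction; [d0| |].

Lemma add_0_l x : 0 + x = x.
Proof.
induct x; [apply add_0_r|]; intros x H; now rewrite add_succ_r, H.
Qed.

Lemma add_succ_l x y : (x + 1) + y = (x + y) + 1.
Proof.
induct y; [now rewrite !add_0_r|]; intros y H; now rewrite !add_succ_r, H.
Qed.

Lemma add_comm x y : x + y = y + x.
Proof.
induct y; [now rewrite add_0_r, add_0_l|]; intros y H.
now rewrite add_succ_r, add_succ_l, H.
Qed.

Lemma add_assoc x y z : x + (y + z) = (x + y) + z.
Proof.
induct z; [now rewrite !add_0_r|]; intros z H; now rewrite !add_succ_r, H.
Qed.

Lemma mul_0_l x : 0 * x = 0.
Proof.
induct x; [apply mul_0_r|]; intros x H; now rewrite mul_succ_r, H, add_0_r.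
Qed.

Lemma mul_succ_l x y : (x + 1) * y = x * y + y.
Proof.
induct y; [now rewrite !mul_0_r, add_0_r|]; intros y H.
rewrite !mul_succ_r, H, !add_succ_r; f_equal.
rewrite <- !add_assoc; f_equal; apply add_comm.
Qed.

Lemma mul_comm x y : x * y = y * x.
Proof.
induct y; [now rewrite mul_0_r, mul_0_l|]; intros y H.
now rewrite mul_succ_r, mul_succ_l, H.
Qed.

Lemma mul_add_l x y z : (x + y) * z = x * z + y * z.
Proof.
induct z; [now rewrite !mul_0_r, add_0_r|]; intros z H.
rewrite !mul_succ_r, H, <- !add_assoc; f_equal.
rewrite !add_assoc; f_equal; apply add_comm.
Qed.

Lemma mul_assoc x y z : x * (y * z) = (x * y) * z.
Proof.
induct z; [now rewrite !mul_0_r|]; intros z H.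
rewrite !mul_succ_r, <- H, (mul_comm x), mul_add_l.
now rewrite (mul_comm _ x), (mul_comm y x).
Qed.

Lemma mul_1_l x : 1 * x = x.
Proof. now rewrite <- (add_0_l 1), mul_succ_l, mul_0_l, add_0_l. Qed.

Lemma num_semiring : semi_ring_theory 0 1 (add M) (mul M) eq.
Proof.
constructor; [exact add_0_l|exact add_comm|exact add_assoc|exact mul_1_l
  |exact mul_0_l|exact mul_comm|exact mul_assoc|exact mul_add_l].
Qed.

Add Ring num_ring : num_semiring.

Lemma lt_trans x y z : x < y -> y < z -> x < z.
Proof.
induct z; [intros _ H; now apply nlt_0 in H|]; intros z IH H1 H2.
apply lt_succ; left; apply lt_succ in H2; destruct H2 as [H2| <-]; auto.
Qed.

Lemma lt_succ_diag x : x < x + 1.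
Proof. apply lt_succ; now right. Qed.

Lemma lt_irrefl x : ~ x < x.
Proof.
induct x; [apply nlt_0|]; intros x IH H; apply lt_succ in H; destruct H as [H|H].
- apply IH, lt_trans with (x + 1); [apply lt_succ_diag|exact H].
- apply IH; rewrite <- H at 2; apply lt_succ_diag.
Qed.

Lemma lt_0_succ x : 0 < x + 1.
Proof.
induct x; [apply lt_succ; right; reflexivity|]; intros x IH; apply lt_succ; now left.
Qed.

Lemma succ_lt_mono x y : x < y -> x + 1 < y + 1.
Proof.
induct y; [intros H; now apply nlt_0 in H|]; intros y IH H.
apply lt_succ in H; destruct H as [H| <-]; apply lt_succ; [left; auto|now right].
Qed.

Lemma lt_total x y : x < y \/ x = y \/ y < x.
Proof.
induct x.
- induct y; [tauto|]; intros y _; left; apply lt_0_succ.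
- intros x [H|[->|H]].
  + apply succ_lt_mono, lt_succ in H; tauto.
  + right; right; apply lt_succ_diag.
  + right; right; apply lt_succ; now left.
Qed.

(** The language has only [<]; the non-strict comparison of [y] with [x] is written [y < x + 1]
    throughout. *)
Lemma nlt_succ x y : ~ x < y <-> y < x + 1.
Proof.
rewrite lt_succ; split.
- intros H; destruct (lt_total x y) as [|[->|]]; tauto.
- intros [H| ->] H1; [|exact (lt_irrefl _ H1)].
  exact (lt_irrefl _ (lt_trans _ _ _ H H1)).
Qed.

Lemma le_lt_trans x y z : x < y + 1 -> y < z -> x < z.
Proof. intros H1 H2; apply lt_succ in H1; destruct H1 as [H1| ->]; eauto using lt_trans. Qed.

Lemma lt_le_trans x y z : x < y -> y < z + 1 -> x < z.
Proof. intros H1 H2; apply lt_succ in H2; destruct H2 as [H2| <-]; eauto using lt_trans. Qed.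

Lemma add_lt_mono_r x y z : x < y -> x + z < y + z.
Proof.
induct z; [now rewrite !add_0_r|]; intros z IH H; rewrite !add_succ_r.
apply succ_lt_mono; auto.
Qed.

Lemma add_cancel_r x y z : x + z = y + z -> x = y.
Proof.
intros H; destruct (lt_total x y) as [H1|[H1|H1]]; [|assumption|];
  apply (add_lt_mono_r _ _ z) in H1; rewrite H in H1; now apply lt_irrefl in H1.
Qed.

Lemma le_add_r x y : x < x + y + 1.
Proof.
induct y; [rewrite add_0_r; apply lt_succ_diag|]; intros y H.
rewrite add_succ_r; apply lt_succ; now left.
Qed.

Lemma le_add_l x y : x < y + x + 1.
Proof. rewrite (add_comm y); apply le_add_r. Qed.

Lemma le_ex x y : x < y + 1 -> exists z, y = x + z.
Proof.
(* The witness is bounded first, because induction is available for [D0] predicates. *)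
enough (H : x < y + 1 -> exists z, z < y + 1 /\ y = x + z).
{ intros Hx; destruct (H Hx) as [z [_ Hz]]; now exists z. }
induct y.
- intros H; exists 0; split; [apply lt_0_succ|].
  apply lt_succ in H; destruct H as [H| ->]; [now apply nlt_0 in H|now rewrite add_0_r].
- intros y IH H; apply lt_succ in H; destruct H as [H| ->].
  + destruct (IH H) as [z [H1 H2]]; exists (z + 1); split; [now apply succ_lt_mono|].
    now rewrite add_succ_r, H2.
  + exists 0; split; [apply lt_0_succ|now rewrite add_0_r].
Qed.

Lemma least (P : N -> Prop) : D0 (fun e => P (e O)) ->
  (exists x, P x) -> exists x, P x /\ forall y, y < x -> ~ P y.
Proof.
intros HP [x Hx]; apply NNPP; intros HN.
assert (H : forall n y, y < n -> ~ P y).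
{ intros n; pattern n; revert n; apply D0_induction.
  - d0.
  - intros y Hy; now apply nlt_0 in Hy.
  - intros n IH y Hy Hp; apply lt_succ in Hy; destruct Hy as [Hy| ->]; [now apply (IH y)|].
    apply HN; exists n; auto. }
exact (H (x + 1) x (lt_succ_diag x) Hx).
Qed.

(** * The pairing function *)

Definition pr (x y : N) : N := (x + y) * (x + y) + x.

Lemma le_square x : x < x * x + 1.
Proof.
destruct (lt_total 0 x) as [H|[<-|H]]; [|apply lt_0_succ|now apply nlt_0 in H].
apply succ_lt_mono, le_ex in H; destruct H as [z ->].
replace ((0 + 1 + z) * (0 + 1 + z)) with ((0 + 1 + z) + (0 + 1 + z) * z) by ring.
apply le_add_r.
Qed.

(** With [s = x + y], the code lies between [s * s] and [s * s + s], hence below the next square. *)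
Lemma pr_lt x y x' y' : x + y < x' + y' -> pr x y < pr x' y'.
Proof.
intros H; unfold pr; apply succ_lt_mono, le_ex in H; destruct H as [z Hz].
rewrite Hz; apply le_lt_trans with ((x + y) * (x + y) + (x + y)).
- replace ((x + y) * (x + y) + (x + y)) with (((x + y) * (x + y) + x) + y) by ring.
  apply le_add_r.
- replace ((x + y + 1 + z) * (x + y + 1 + z) + x') with
    ((x + y) * (x + y) + (x + y) +
     (x + y + z + (x + y + 1 + z) * z + (x + y) * z + x') + 1) by ring.
  apply le_add_r.
Qed.

Lemma pr_inj x y x' y' : pr x y = pr x' y' -> x = x' /\ y = y'.
Proof.
intros H; destruct (lt_total (x + y) (x' + y')) as [H1|[H1|H1]].
- apply pr_lt in H1; rewrite H in H1; now apply lt_irrefl in H1.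
- unfold pr in H; rewrite H1 in H.
  assert (E : x = x').
  { apply (add_cancel_r _ _ ((x' + y') * (x' + y'))); rewrite !(add_comm _ (_ * _)); exact H. }
  split; [exact E|]; subst x'; apply (add_cancel_r _ _ x); rewrite !(add_comm _ x); exact H1.
- apply pr_lt in H1; rewrite H in H1; now apply lt_irrefl in H1.
Qed.

Lemma pr_le_l x y : x < pr x y + 1.
Proof. apply le_add_l. Qed.

Lemma pr_le_r x y : y < pr x y + 1.
Proof.
apply le_lt_trans with (x + y); [apply le_add_l|].
apply le_lt_trans with ((x + y) * (x + y)); [apply le_square|apply le_add_r].
Qed.

Lemma D2_comprehension (Q : N -> N -> Prop) : D2 Q -> exists X,
  (forall x y, pr x y \in X <-> Q x y) /\
  (forall n, n \in X -> exists x y, n = pr x y /\ Q x y).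
Proof.
intros HQ; destruct (D0_comprehension (fun n => exists x, x < n + 1 /\
  exists y, y < n + 1 /\ (n = pr x y /\ Q x y))) as [X HX].
{ d0; apply HQ; t0. }
exists X; split.
- intros x y; rewrite HX; split.
  + intros (x' & _ & y' & _ & E & H); apply pr_inj in E; destruct E as [-> ->]; exact H.
  + intros H; exists x; split; [apply pr_le_l|]; exists y; split; [apply pr_le_r|tauto].
- intros n Hn; apply HX in Hn; destruct Hn as (x & _ & y & _ & H); now exists x, y.
Qed.

(** * Greedy cuts *)

Section Greedy.

(** [E b a] is a conflict between the right item [b] and the left item [a].
    [rejL a] and [rejR b] unfold two steps of the greedy recursion "rejected if
    in conflict with an accepted earlier item"; the Ferrers property lets the
    last, negated clause replace the further steps. *)
Definition rejL (E : N -> N -> Prop) (a : N) : Prop :=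
  exists b, b < a + 1 /\ (E b a /\
    forall a', a' < b -> E b a' -> exists b', b' < a' + 1 /\ (E b' a' /\ ~ E b' a)).

Definition rejR (E : N -> N -> Prop) (b : N) : Prop :=
  exists a, a < b /\ (E b a /\
    forall b', b' < a + 1 -> E b' a -> exists a', a' < b' /\ (E b' a' /\ ~ E b a')).

Variable E : N -> N -> Prop.
Hypothesis E_D2 : D2 E.
Hypothesis ferrers : forall b a b' a', E b a -> E b' a' -> E b a' \/ E b' a.

(** The very [b] that witnesses the rejection of [a] is accepted: rejecting [b] would yield [b'] and
    [a'] with [E b a] and [E b' a'] but neither [E b a'] nor [E b' a], against Ferrers. *)
Lemma rejL_killer a : rejL E a -> exists b, b < a + 1 /\ E b a /\ ~ rejR E b.
Proof.
intros (b & Hb & Hba & H); exists b; repeat split; auto.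
intros (a1 & Ha1 & Hba1 & H1).
destruct (H a1 Ha1 Hba1) as (b' & Hb' & Hb'a1 & Hb'a).
destruct (H1 b' Hb' Hb'a1) as (a' & Ha' & Hb'a' & Hba').
destruct (ferrers b a b' a' Hba Hb'a'); contradiction.
Qed.

Lemma rejR_killer b : rejR E b -> exists a, a < b /\ E b a /\ ~ rejL E a.
Proof.
intros (a & Ha & Hba & H); exists a; repeat split; auto.
intros (b1 & Hb1 & Hb1a & H1).
destruct (H b1 Hb1 Hb1a) as (a' & Ha' & Hb1a' & Hba').
destruct (H1 a' Ha' Hb1a') as (b' & Hb' & Hb'a' & Hb'a).
destruct (ferrers b a b' a' Hba Hb'a'); contradiction.
Qed.

Lemma not_rejL a : ~ rejL E a -> forall b, b < a + 1 -> E b a ->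
  exists a', a' < b /\ E b a' /\ forall b', b' < a' + 1 -> E b' a' -> E b' a.
Proof.
intros H b Hb Hba; apply NNPP; intros HN; apply H; exists b; repeat split; auto.
intros a' Ha' Hba'; apply NNPP; intros HN'; apply HN; exists a'; repeat split; auto.
intros b' Hb' Hb'a'; apply NNPP; intros Hb'a; apply HN'; exists b'; auto.
Qed.

Lemma not_rejR b : ~ rejR E b -> forall a, a < b -> E b a ->
  exists b', b' < a + 1 /\ E b' a /\ forall a', a' < b' -> E b' a' -> E b a'.
Proof.
intros H a Ha Hba; apply NNPP; intros HN; apply H; exists a; repeat split; auto.
intros b' Hb' Hb'a; apply NNPP; intros HN'; apply HN; exists b'; repeat split; auto.
intros a' Ha' Hb'a'; apply NNPP; intros Hba'; apply HN'; exists a'; auto.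
Qed.

(** Descent. If [b <= a], acceptance of [a] gives an earlier [a1] that defends it against [b], that
    is, every earlier right item in conflict with [a1] conflicts with [a]. Taking [a1] least,
    acceptance of [b] and then of [a] produce [b1] and a still smaller defender [a2]. The case
    [a < b] is dual. *)
Lemma greedy_independent a b : ~ rejL E a -> ~ rejR E b -> ~ E b a.
Proof.
intros HL HR Hba.
pose proof lt_trans as Htr; pose proof le_lt_trans as Hle.
(* The split is on which item is treated first; at equal codes it is the right item [b]. *)
destruct (classic (b < a + 1)) as [H|H].
- destruct (least (fun a' => E b a' /\ a' < b /\
    forall b', b' < a' + 1 -> E b' a' -> E b' a)) as (a1 & (H1 & H2 & H3) & H4).
  { d0; apply E_D2; t0. }
  { destruct (not_rejL a HL b H Hba) as (a1 & H1 & H2 & H3); exists a1; auto. }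
  destruct (not_rejR b HR a1 H2 H1) as (b1 & H5 & H6 & H7).
  assert (Hb1a : E b1 a) by auto.
  assert (Hb1 : b1 < b) by (eapply Hle; eauto).
  destruct (not_rejL a HL b1) as (a2 & H8 & H9 & H10); auto.
  { eapply Htr; eauto. }
  assert (Ha2 : a2 < a1) by (eapply lt_le_trans; eauto).
  apply (H4 a2 Ha2); repeat split; auto; eapply Htr; eauto.
- assert (H' : a < b).
  { apply nlt_succ in H; apply lt_succ in H.
    destruct H as [H|H].
    - eapply Htr; [|exact H]; apply lt_succ_diag.
    - rewrite <- H; apply lt_succ_diag. }
  destruct (least (fun b' => E b' a /\ b' < a + 1 /\
    forall a', a' < b' -> E b' a' -> E b a')) as (b1 & (H1 & H2 & H3) & H4).
  { d0; apply E_D2; t0. }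
  { destruct (not_rejR b HR a H' Hba) as (b1 & H1 & H2 & H3); exists b1; auto. }
  destruct (not_rejL a HL b1 H2 H1) as (a1 & H5 & H6 & H7).
  assert (Hba1 : E b a1) by auto.
  assert (Ha1 : a1 < b).
  { eapply Htr; [exact H5|eapply Hle; eauto]. }
  destruct (not_rejR b HR a1) as (b2 & H8 & H9 & H10); auto.
  assert (Hb2 : b2 < b1) by (eapply Hle; eauto).
  apply (H4 b2 Hb2); repeat split; auto; eapply Htr; eauto.
Qed.

End Greedy.

(** * The linear order of cuts *)

Section ProperIntervalOrders.

Variables P R : set M.

Notation "x ≺ y" := (pr x y \in R /\ x <> y) (at level 70).

Hypothesis R_dom : forall x y, x ≺ y -> x \in P /\ y \in P.
Hypothesis R_22 : forall a b c d, a ≺ b -> c ≺ d -> a ≺ d \/ c ≺ b.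
Hypothesis R_31 : forall a b c d, a ≺ b -> b ≺ c -> d \in P -> a ≺ d \/ d ≺ c.

Lemma R_irrefl x : ~ x ≺ x.
Proof. tauto. Qed.

(** In terms of positions, [pos v <= pos u + 1]. This is when the right item [pos v + 1] conflicts
    with the left item [pos u + 2], and when [pos v - 1] conflicts with [pos u]. *)
Definition ninc (u v : N) : Prop := u \in P /\ v \in P /\ ~ u ≺ v.

(** The left items are [pr u 0] for [pos u] and [pr u 1] for [pos u + 2], the
    right items [pr v 0] for [pos v + 1] and [pr v 1] for [pos v - 1].  The
    items with index 1 take part in family [f = 0] on the left only, and in
    family [f = 1] on the right only. *)
Definition conflict (f b a : N) : Prop :=
  exists u, u < a + 1 /\ exists v, v < b + 1 /\
    ((a = pr u 0 /\ b = pr v 0 /\ v ≺ u) \/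
     (f = 0 /\ a = pr u 1 /\ b = pr v 0 /\ ninc u v) \/
     (f = 1 /\ a = pr u 0 /\ b = pr v 1 /\ ninc u v)).

(** [lo] and [hi] are the initial left and right item of a greedy cut. *)
Record point : Type := Point { fam : N; lo : N; hi : N }.

(** Items in conflict with an initial item are decided beforehand, which amounts
    to accepting the initial items first. *)
Definition live_conflict (z : point) (b a : N) : Prop :=
  conflict (fam z) b a /\ ~ conflict (fam z) b (lo z) /\ ~ conflict (fam z) (hi z) a.

Definition cutL (z : point) (a : N) : Prop :=
  ~ conflict (fam z) (hi z) a /\ ~ rejL (live_conflict z) a.

(** Marks the rejected right items, those that fall on the left of the cut. With this orientation
    both [cutL] and [cutR] grow as the cut moves to the right. *)
Definition cutR (z : point) (b : N) : Prop :=
  conflict (fam z) b (lo z) \/ rejR (live_conflict z) b.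

(** Comparing a cut of family 1 with one of family 0 looks at [lo] of the former and [hi] of the
    latter; these are therefore required to be items of index 0, which both families share. *)
Definition valid (z : point) : Prop :=
  ((fam z = 0 /\ exists v, v < hi z + 1 /\ hi z = pr v 0) \/
   (fam z = 1 /\ exists u, u < lo z + 1 /\ lo z = pr u 0)) /\
  ~ conflict (fam z) (hi z) (lo z).

Definition below (z z' : point) : Prop := cutL z' (lo z) /\ ~ cutR z (hi z').

(** When no initial item separates cuts of different families, all later
    differences put the cut of family 1 first; so do ties. *)
Definition preceq (z z' : point) : Prop :=
  ((fam z = fam z' \/ (fam z = 1 /\ fam z' = 0)) /\ below z z') \/
  (fam z = 0 /\ fam z' = 1 /\ ~ below z' z).

Definition code (z : point) : N := pr (fam z) (pr (lo z) (hi z)).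

(** [preceq] is a total preorder on valid points; the codes break its ties to give antisymmetry. *)
Definition point_le (z z' : point) : Prop :=
  preceq z z' /\ (preceq z' z -> code z < code z' + 1).

(** Existential decoding with bounded components keeps predicates of points [D0]; as [code] is
    injective, it is just [Q] at the decoded point. *)
Definition decoded (x : N) (Q : point -> Prop) : Prop :=
  exists f, f < x + 1 /\ exists w, w < x + 1 /\ exists a, a < w + 1 /\
  exists b, b < w + 1 /\ (x = pr f (pr a b) /\ Q (Point f a b)).

(** * Definability of the cuts, their order and incidence *)

Lemma D0_conflict f b a : T0 f -> T0 b -> T0 a ->
  D0 (fun e => conflict (f e) (b e) (a e)).
Proof. intros; unfold conflict, ninc; d0. Qed.

Opaque conflict.

Ltac dc := d0; apply D0_conflict; t0.

Lemma D0_cutL f a b x : T0 f -> T0 a -> T0 b -> T0 x ->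
  D0 (fun e => cutL (Point (f e) (a e) (b e)) (x e)).
Proof. intros; unfold cutL, rejL, live_conflict; cbn [fam lo hi]; dc. Qed.

Lemma D0_cutR f a b x : T0 f -> T0 a -> T0 b -> T0 x ->
  D0 (fun e => cutR (Point (f e) (a e) (b e)) (x e)).
Proof. intros; unfold cutR, rejR, live_conflict; cbn [fam lo hi]; dc. Qed.

Opaque cutL cutR.

Lemma D0_preceq f a b f' a' b' :
  T0 f -> T0 a -> T0 b -> T0 f' -> T0 a' -> T0 b' ->
  D0 (fun e => preceq (Point (f e) (a e) (b e)) (Point (f' e) (a' e) (b' e))).
Proof.
intros; unfold preceq, below; cbn [fam lo hi]; d0;
  solve [apply D0_cutL; t0|apply D0_cutR; t0].
Qed.

Lemma D0_valid f a b : T0 f -> T0 a -> T0 b ->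
  D0 (fun e => valid (Point (f e) (a e) (b e))).
Proof. intros; unfold valid; cbn [fam lo hi]; dc. Qed.

Lemma D0_decoded tau (Q : (nat -> N) -> point -> Prop) : T0 tau ->
  D0 (fun e => Q (fun n => e (S (S (S (S n))))) (Point (e 3) (e 1%nat) (e O))) ->
  D0 (fun e => decoded (tau e) (Q e)).
Proof. intros; unfold decoded; d0. Qed.

Opaque preceq valid decoded.

Lemma point_le_D2 : D2 (fun x y => decoded x (fun z => decoded y (fun z' =>
  valid z /\ valid z' /\ point_le z z'))).
Proof.
intros tau sigma Ht Hs; unfold point_le, code.
apply D0_decoded; [t0|]; cbv beta; apply D0_decoded; [t0|]; cbn [fam lo hi]; d0;
  solve [apply D0_valid; t0|apply D0_preceq; t0].
Qed.

Lemma points_D0 : D0 (fun e => decoded (e O) valid).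
Proof.
apply (D0_decoded (fun e => e O) (fun _ => valid)); [t0|]; apply D0_valid; t0.
Qed.

Lemma incidence_D2 : D2 (fun p x => p \in P /\ decoded x (fun z =>
  valid z /\ cutL z (pr p 0) /\ ~ cutR z (pr p 0))).
Proof.
intros tau sigma Ht Hs; d0; apply D0_decoded; [t0|]; cbv beta; d0;
  solve [apply D0_valid; t0|apply D0_cutL; t0|apply D0_cutR; t0].
Qed.

Transparent conflict cutL cutR preceq valid decoded.

Lemma decoded_code z (Q : point -> Prop) : decoded (code z) Q <-> Q z.
Proof.
destruct z as [f a b]; unfold decoded, code; cbn [fam lo hi]; split.
- intros (f' & _ & w & _ & a' & _ & b' & _ & H & HQ).
  apply pr_inj in H; destruct H as [-> H].
  apply pr_inj in H; destruct H as [-> ->]; exact HQ.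
- intros HQ; exists f; split; [apply pr_le_l|].
  exists (pr a b); split; [apply pr_le_r|].
  exists a; split; [apply pr_le_l|].
  exists b; split; [apply pr_le_r|auto].
Qed.

Lemma decoded_inv x (Q : point -> Prop) : decoded x Q -> exists z, x = code z /\ Q z.
Proof. intros (f & _ & w & _ & a & _ & b & _ & -> & HQ); now exists (Point f a b). Qed.

Lemma code_inj z z' : code z = code z' -> z = z'.
Proof.
intros H; apply (decoded_code z (fun y => y = z')); rewrite H; now apply decoded_code.
Qed.

(** * The conflict relation *)

Lemma one_neq_zero : 1 <> 0.
Proof. rewrite <- (add_0_l 1); apply succ_neq_0. Qed.

Lemma conflict_00 f u v : v ≺ u -> conflict f (pr v 0) (pr u 0).
Proof.
intros H; exists u; split; [apply pr_le_l|].
exists v; split; [apply pr_le_l|]; auto 8.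
Qed.

Lemma conflict_10 u v : ninc u v -> conflict 0 (pr v 0) (pr u 1).
Proof.
intros H; exists u; split; [apply pr_le_l|].
exists v; split; [apply pr_le_l|]; auto 8.
Qed.

Lemma conflict_01 u v : ninc u v -> conflict 1 (pr v 1) (pr u 0).
Proof.
intros H; exists u; split; [apply pr_le_l|].
exists v; split; [apply pr_le_l|]; auto 8.
Qed.

Lemma conflict_inv f b a : conflict f b a -> exists u v,
  (a = pr u 0 /\ b = pr v 0 /\ v ≺ u) \/
  (f = 0 /\ a = pr u 1 /\ b = pr v 0 /\ ninc u v) \/
  (f = 1 /\ a = pr u 0 /\ b = pr v 1 /\ ninc u v).
Proof. intros (u & _ & v & _ & H); now exists u, v. Qed.

Lemma conflict_00_inv f u v : conflict f (pr v 0) (pr u 0) -> v ≺ u.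
Proof.
intros H; apply conflict_inv in H.
destruct H as (u' & v' & [(E1 & E2 & H)|[(_ & E1 & E2 & H)|(_ & E1 & E2 & H)]]);
  apply pr_inj in E1, E2; destruct E1 as [-> E1], E2 as [-> E2].
- exact H.
- symmetry in E1; now apply one_neq_zero in E1.
- symmetry in E2; now apply one_neq_zero in E2.
Qed.

Lemma conflict_10_inv u v : conflict 0 (pr v 0) (pr u 1) -> ninc u v.
Proof.
intros H; apply conflict_inv in H.
destruct H as (u' & v' & [(E1 & E2 & H)|[(_ & E1 & E2 & H)|(E & E1 & E2 & H)]]);
  apply pr_inj in E1, E2; destruct E1 as [-> E1], E2 as [-> E2].
- now apply one_neq_zero in E1.
- exact H.
- symmetry in E; now apply one_neq_zero in E.
Qed.

Lemma conflict_01_inv u v : conflict 1 (pr v 1) (pr u 0) -> ninc u v.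
Proof.
intros H; apply conflict_inv in H.
destruct H as (u' & v' & [(E1 & E2 & H)|[(E & E1 & E2 & H)|(E & E1 & E2 & H)]]);
  apply pr_inj in E1, E2; destruct E1 as [-> E1], E2 as [-> E2].
- now apply one_neq_zero in E2.
- now apply one_neq_zero in E.
- exact H.
Qed.

(** On positions a conflict compares a right item with a left one, and such a relation is Ferrers.
    Two conflicts of the same kind reduce to excluding 2+2, an ordinary one and one with an item of
    index 1 to excluding 3+1. The two kinds with index 1 never meet, as they belong to different
    families. *)
Lemma conflict_ferrers f b a b' a' :
  conflict f b a -> conflict f b' a' -> conflict f b a' \/ conflict f b' a.
Proof.
intros H H'; apply conflict_inv in H, H'.
destruct H as (u & v & [(-> & -> & H)|[(Ef & -> & -> & H)|(Ef & -> & -> & H)]]),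
  H' as (u' & v' & [(-> & -> & H')|[(Ef' & -> & -> & H')|(Ef' & -> & -> & H')]]);
  subst; try (symmetry in Ef'; now apply one_neq_zero in Ef');
  try now apply one_neq_zero in Ef'.
- destruct (R_22 _ _ _ _ H H'); [left|right]; now apply conflict_00.
- destruct H' as (Hu' & Hv' & H'); destruct (classic (u' ≺ v)) as [H1|H1].
  + destruct (R_31 _ _ _ v' H1 H Hv') as [H2|H2]; [contradiction|].
    right; now apply conflict_00.
  + left; apply conflict_10; repeat split; auto; now apply R_dom in H.
- destruct H' as (Hu' & Hv' & H'); destruct (classic (u ≺ v')) as [H1|H1].
  + destruct (R_31 _ _ _ u' H H1 Hu') as [H2|H2]; [|contradiction].
    left; now apply conflict_00.
  + right; apply conflict_01; repeat split; auto; now apply R_dom in H.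
- destruct H as (Hu & Hv & H); destruct (classic (u ≺ v')) as [H1|H1].
  + destruct (R_31 _ _ _ v H1 H' Hv) as [H2|H2]; [contradiction|].
    left; now apply conflict_00.
  + right; apply conflict_10; repeat split; auto; now apply R_dom in H'.
- destruct H as (Hu & Hv & H), H' as (Hu' & Hv' & H').
  destruct (classic (u' ≺ v)) as [H1|H1].
  + destruct (classic (u ≺ v')) as [H2|H2].
    * destruct (R_22 _ _ _ _ H1 H2); contradiction.
    * right; now apply conflict_10.
  + left; now apply conflict_10.
- destruct H as (Hu & Hv & H); destruct (classic (u' ≺ v)) as [H1|H1].
  + destruct (R_31 _ _ _ u H' H1 Hu) as [H2|H2]; [|contradiction].
    right; now apply conflict_00.
  + left; apply conflict_01; repeat split; auto; now apply R_dom in H'.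
- destruct H as (Hu & Hv & H), H' as (Hu' & Hv' & H').
  destruct (classic (u' ≺ v)) as [H1|H1].
  + destruct (classic (u ≺ v')) as [H2|H2].
    * destruct (R_22 _ _ _ _ H1 H2); contradiction.
    * right; now apply conflict_01.
  + left; now apply conflict_01.
Qed.

Lemma live_ferrers z b a b' a' : live_conflict z b a -> live_conflict z b' a' ->
  live_conflict z b a' \/ live_conflict z b' a.
Proof.
intros (H1 & H2 & H3) (H1' & H2' & H3').
destruct (conflict_ferrers _ _ _ _ _ H1 H1'); [left|right]; repeat split; auto.
Qed.

Lemma live_D2 z : D2 (live_conflict z).
Proof. intros t s Ht Hs; unfold live_conflict; dc. Qed.

(** * Accepted and rejected items of a cut *)

Lemma cut_independent z b a : cutL z a -> ~ cutR z b -> ~ conflict (fam z) b a.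
Proof.
intros [H1 H2] H3 H.
assert (HR : ~ rejR (live_conflict z) b) by (intros HR; apply H3; now right).
apply (greedy_independent _ (live_D2 z) a b H2 HR).
repeat split; auto; intros Hb; apply H3; now left.
Qed.

Lemma cutL_lo z : valid z -> cutL z (lo z).
Proof. intros [_ Hz]; split; [exact Hz|]; intros (b & _ & (H1 & H2 & _) & _); auto. Qed.

Lemma cutR_hi z : valid z -> ~ cutR z (hi z).
Proof. intros [_ Hz] [H|(a & _ & (H1 & H2 & H3) & _)]; auto. Qed.

(** The bound on the code of a killer other than the initial item drives the descent in
    [below_incl]. *)
Lemma cutL_killer z a : valid z -> ~ cutL z a ->
  exists b, ~ cutR z b /\ conflict (fam z) b a /\ (b = hi z \/ b < a + 1).
Proof.
intros Hz H; destruct (classic (conflict (fam z) (hi z) a)) as [H1|H1].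
- exists (hi z); repeat split; auto using cutR_hi.
- assert (HL : rejL (live_conflict z) a) by (apply NNPP; intros HL; apply H; now split).
  apply (rejL_killer _ (live_ferrers z)) in HL; destruct HL as (b & Hb & (H2 & H3 & H4) & H5).
  exists b; repeat split; auto; intros [H6|H6]; contradiction.
Qed.

Lemma cutR_killer z b : valid z -> cutR z b ->
  exists a, cutL z a /\ conflict (fam z) b a /\ (a = lo z \/ a < b).
Proof.
intros Hz [H|H].
- exists (lo z); repeat split; auto; apply cutL_lo; assumption.
- apply (rejR_killer _ (live_ferrers z)) in H; destruct H as (a & Ha & (H2 & H3 & H4) & H5).
  exists a; repeat split; auto.
Qed.

(** * Comparison of cuts *)

Definition common (f f' a : N) : Prop :=
  f = f' \/ exists u, u < a + 1 /\ a = pr u 0.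

(** Family 0 has no right items of index 1 in its conflicts, and family 1 no left ones. So a
    conflict of family 0 with a common left item, or of family 1 with a common right item, involves
    common items only and is a conflict of both families. *)
Lemma conflict_change f f' b a : (f = f' \/ (f = 1 /\ f' = 0)) ->
  (common f f' a /\ conflict f' b a -> common f f' b /\ conflict f b a) /\
  (common f f' b /\ conflict f b a -> common f f' a /\ conflict f' b a).
Proof.
intros [<-|[-> ->]].
{ unfold common; tauto. }
split; intros [H1 H2]; apply conflict_inv in H2; unfold common;
  destruct H2 as (u & v & [(-> & -> & H)|[(E & -> & -> & H)|(E & -> & -> & H)]]).
- split; [|now apply conflict_00].
  right; exists v; split; [apply pr_le_l|reflexivity].
- destruct H1 as [H1|(u' & _ & E')]; [now apply one_neq_zero in H1|].
  apply pr_inj in E'; destruct E' as [_ E']; now apply one_neq_zero in E'.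
- symmetry in E; now apply one_neq_zero in E.
- split; [|now apply conflict_00].
  right; exists u; split; [apply pr_le_l|reflexivity].
- now apply one_neq_zero in E.
- destruct H1 as [H1|(u' & _ & E')]; [now apply one_neq_zero in H1|].
  apply pr_inj in E'; destruct E' as [_ E']; now apply one_neq_zero in E'.
Qed.

(** Take the least common left item [a] accepted by [z] but not by [z']. Its killer [b] in [z'] is
    rejected by [z], and the killer of [b] in [z] is again accepted by [z] but not by [z']. By
    [below] neither killer is an initial item, so the second one is smaller than [a]. *)
Lemma below_incl z z' : valid z -> valid z' ->
  (fam z = fam z' \/ (fam z = 1 /\ fam z' = 0)) -> below z z' ->
  (forall a, common (fam z) (fam z') a -> cutL z a -> cutL z' a) /\
  (forall b, common (fam z) (fam z') b -> cutR z b -> cutR z' b).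
Proof.
intros Hz Hz' Hf [HL HR].
assert (HRL : forall b, common (fam z) (fam z') b -> cutR z b -> ~ cutR z' b ->
  exists a, common (fam z) (fam z') a /\ cutL z a /\ ~ cutL z' a /\ a < b).
{ intros b Hb H1 H2; destruct (cutR_killer z b Hz H1) as (a & H3 & H4 & H5).
  destruct (proj2 (conflict_change _ _ b a Hf) (conj Hb H4)) as [Ha H6].
  assert (H7 : ~ cutL z' a) by (intros H7; now apply (cut_independent z' b a)).
  exists a; refine (conj Ha (conj H3 (conj H7 _))).
  destruct H5 as [->|]; [contradiction|assumption]. }
assert (HLR : forall a, common (fam z) (fam z') a -> cutL z a -> ~ cutL z' a ->
  exists b, common (fam z) (fam z') b /\ cutR z b /\ ~ cutR z' b /\ b < a + 1).
{ intros a Ha H1 H2; destruct (cutL_killer z' a Hz' H2) as (b & H3 & H4 & H5).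
  destruct (proj1 (conflict_change _ _ b a Hf) (conj Ha H4)) as [Hb H6].
  assert (H7 : cutR z b) by (apply NNPP; intros H7; now apply (cut_independent z b a)).
  exists b; refine (conj Hb (conj H7 (conj H3 _))).
  destruct H5 as [->|]; [contradiction|assumption]. }
assert (H : forall a, common (fam z) (fam z') a -> cutL z a -> cutL z' a).
{ intros a Ha H1; apply NNPP; intros H2.
  destruct (least (fun a => common (fam z) (fam z') a /\ cutL z a /\ ~ cutL z' a))
    as (a1 & (H3 & H4 & H5) & H6).
  { destruct z as [f x y], z' as [f' x' y']; unfold common; cbn [fam].
    Opaque cutL. d0; apply D0_cutL; t0. }
  { exists a; auto. }
  destruct (HLR a1 H3 H4 H5) as (b & H7 & H8 & H9 & H10).
  destruct (HRL b H7 H8 H9) as (a2 & H11 & H12 & H13 & H14).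
  apply (H6 a2); [|auto]; eapply lt_le_trans; eauto. }
split; [exact H|]; intros b Hb H1; apply NNPP; intros H2.
destruct (HRL b Hb H1 H2) as (a & H3 & H4 & H5 & _); auto.
Qed.
Transparent cutL.

(** Inclusion on the items of index 0, which both families share and on which incidence depends. *)
Definition sub (z z' : point) : Prop :=
  (forall u, cutL z (pr u 0) -> cutL z' (pr u 0)) /\
  (forall v, cutR z (pr v 0) -> cutR z' (pr v 0)).

Lemma below_sub z z' : valid z -> valid z' ->
  (fam z = fam z' \/ (fam z = 1 /\ fam z' = 0)) -> below z z' -> sub z z'.
Proof.
intros Hz Hz' Hf H; destruct (below_incl z z' Hz Hz' Hf H) as [HL HR].
split; intros u; [apply HL|apply HR]; right; exists u;
  (split; [apply pr_le_l|reflexivity]).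
Qed.

Lemma below_trans z1 z2 z3 : valid z1 -> valid z2 -> valid z3 ->
  fam z1 = fam z2 -> fam z2 = fam z3 -> below z1 z2 -> below z2 z3 -> below z1 z3.
Proof.
intros Hz1 Hz2 Hz3 E1 E2 H1 H2.
destruct (below_incl z1 z2 Hz1 Hz2 (or_introl E1) H1) as [HL1 HR1].
destruct (below_incl z2 z3 Hz2 Hz3 (or_introl E2) H2) as [HL2 HR2].
split.
- apply HL2; [now left|]; apply H1.
- intros H; apply H2, HR1; [now left|exact H].
Qed.

Lemma sub_below z z' : valid z -> valid z' -> fam z = 1 -> fam z' = 0 ->
  sub z z' -> below z z'.
Proof.
intros Hz Hz' Ef Ef' [HL HR]; pose proof (cutL_lo z Hz); pose proof (cutR_hi z' Hz').
destruct Hz as [[[E _]|[_ (u & _ & Eu)]] _]; [rewrite Ef in E; now apply one_neq_zero in E|].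
destruct Hz' as [[[_ (v & _ & Ev)]|[E _]] _];
  [|rewrite Ef' in E; symmetry in E; now apply one_neq_zero in E].
unfold below; rewrite Eu, Ev in *; auto.
Qed.

(** If both comparisons fail, there are two conflicts: a right item accepted by [z'] against a left
    item accepted by [z], and one with the cuts exchanged. By Ferrers two items accepted by the same
    cut are then in conflict. *)
Lemma below_total z z' : valid z -> valid z' -> fam z = fam z' ->
  below z z' \/ below z' z.
Proof.
intros Hz Hz' E; destruct (classic (below z z')) as [H|H]; [now left|right].
apply not_and_or in H; destruct H as [H|H].
- destruct (cutL_killer z' _ Hz' H) as (b & H1 & H2 & _).
  assert (H3 : cutR z b).
  { apply NNPP; intros H3; apply (cut_independent z b (lo z)); auto using cutL_lo.
    now rewrite E. }
  split.
  + apply NNPP; intros H4; destruct (cutL_killer z _ Hz H4) as (c & H5 & H6 & _).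
    rewrite E in H6; destruct (conflict_ferrers _ _ _ _ _ H2 H6) as [H7|H7].
    * apply (cut_independent z' b (lo z')); auto using cutL_lo.
    * apply (cut_independent z c (lo z)); auto using cutL_lo; now rewrite E.
  + intros H4; destruct (cutR_killer z' _ Hz' H4) as (a & H5 & H6 & _).
    destruct (conflict_ferrers _ _ _ _ _ H2 H6) as [H7|H7].
    * now apply (cut_independent z' b a).
    * apply (proj2 Hz); now rewrite E.
- apply NNPP in H; destruct (cutR_killer z _ Hz H) as (a & H1 & H2 & _).
  assert (H3 : ~ cutL z' a).
  { intros H3; apply (cut_independent z' (hi z') a); auto using cutR_hi.
    now rewrite <- E. }
  split.
  + apply NNPP; intros H4; destruct (cutL_killer z _ Hz H4) as (c & H5 & H6 & _).
    destruct (conflict_ferrers _ _ _ _ _ H2 H6) as [H7|H7].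
    * apply (proj2 Hz'); now rewrite <- E.
    * now apply (cut_independent z c a).
  + intros H4; destruct (cutR_killer z' _ Hz' H4) as (c & H5 & H6 & _).
    rewrite <- E in H6; destruct (conflict_ferrers _ _ _ _ _ H2 H6) as [H7|H7].
    * apply (cut_independent z' (hi z') c); auto using cutR_hi; now rewrite <- E.
    * apply (cut_independent z (hi z) a); auto using cutR_hi.
Qed.

(** The argument of [below_total] across families. The failure of [below] yields a conflict
    belonging to both families, so that Ferrers can be applied in the family of whichever cut
    supplies the second conflict. *)
Lemma not_below_sub z z' : valid z -> valid z' -> fam z = 1 -> fam z' = 0 ->
  ~ below z z' -> sub z' z.
Proof.
intros Hz Hz' Ef Ef' H; pose proof (cutL_lo z Hz) as Hlo; pose proof (cutR_hi z' Hz') as Hhi.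
assert (Hu : exists u, lo z = pr u 0).
{ destruct Hz as [[[E _]|[_ (u & _ & Eu)]] _]; [|now exists u].
  rewrite Ef in E; now apply one_neq_zero in E. }
assert (Hv : exists v, hi z' = pr v 0).
{ destruct Hz' as [[[_ (v & _ & Ev)]|[E _]] _]; [now exists v|].
  rewrite Ef' in E; symmetry in E; now apply one_neq_zero in E. }
assert (Hf : fam z = fam z' \/ (fam z = 1 /\ fam z' = 0)) by (right; now split).
assert (HcL : forall w, common (fam z) (fam z') (pr w 0)).
{ intros w; right; exists w; split; [apply pr_le_l|reflexivity]. }
assert (H1 : exists b a, ~ cutR z' b /\ cutL z a /\ conflict (fam z) b a /\
  conflict (fam z') b a).
{ apply not_and_or in H; destruct H as [H|H].
  - destruct (cutL_killer z' _ Hz' H) as (b & H1 & H2 & _).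
    exists b, (lo z); repeat split; try (apply Hlo); auto.
    destruct Hu as [u Eu]; rewrite Eu in *.
    now apply (proj1 (conflict_change _ _ b _ Hf)).
  - apply NNPP in H; destruct (cutR_killer z _ Hz H) as (a & H1 & H2 & _).
    exists (hi z'), a; repeat split; try apply H1; auto.
    destruct Hv as [v Ev]; rewrite Ev in *.
    now apply (proj2 (conflict_change _ _ _ a Hf)). }
destruct H1 as (b & a & Hb & Ha & Hc & Hc'); split; intros w Hw; apply NNPP; intros HN.
- destruct (cutL_killer z _ Hz HN) as (c & H1 & H2 & _).
  destruct (conflict_ferrers _ _ _ _ _ Hc H2) as [H3|H3].
  + apply (cut_independent z' b (pr w 0)); auto.
    assert (Eb : exists v, b = pr v 0).
    { rewrite Ef' in Hc'; apply conflict_inv in Hc'.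
      destruct Hc' as (u & v & [(_ & E & _)|[(_ & _ & E & _)|(E & _)]]); [now exists v..|].
      symmetry in E; now apply one_neq_zero in E. }
    destruct Eb as [v ->]; apply conflict_00_inv in H3; now apply conflict_00.
  + now apply (cut_independent z c a).
- destruct (cutR_killer z' _ Hz' Hw) as (c & H1 & H2 & _).
  destruct (conflict_ferrers _ _ _ _ _ Hc' H2) as [H3|H3].
  + now apply (cut_independent z' b c).
  + apply (cut_independent z (pr w 0) a); auto.
    assert (Ea : exists u, a = pr u 0).
    { rewrite Ef in Hc; apply conflict_inv in Hc.
      destruct Hc as (u & v & [(E & _)|[(E & _)|(_ & E & _)]]); [now exists u| |now exists u].
      now apply one_neq_zero in E. }
    destruct Ea as [u ->]; apply conflict_00_inv in H3; now apply conflict_00.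
Qed.

Lemma valid_fam z : valid z -> fam z = 0 \/ fam z = 1.
Proof. intros [[[H _]|[H _]] _]; auto. Qed.

Lemma preceq_same z z' : fam z = fam z' -> preceq z z' <-> below z z'.
Proof.
intros E; unfold preceq; split; [|tauto].
intros [[_ H]|(E1 & E2 & _)]; [exact H|].
rewrite E1, E2 in E; symmetry in E; now apply one_neq_zero in E.
Qed.

Lemma preceq_10 z z' : fam z = 1 -> fam z' = 0 -> preceq z z' <-> below z z'.
Proof.
intros E E'; unfold preceq; split; [|tauto].
intros [[_ H]|(E1 & E2 & _)]; [exact H|].
rewrite E in E1; now apply one_neq_zero in E1.
Qed.

Lemma preceq_01 z z' : fam z = 0 -> fam z' = 1 -> preceq z z' <-> ~ below z' z.
Proof.
intros E E'; unfold preceq; split; [|tauto].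
intros [[[E1|[E1 _]] H]|(E1 & E2 & H)]; [| |exact H].
- rewrite E, E' in E1; symmetry in E1; now apply one_neq_zero in E1.
- rewrite E in E1; symmetry in E1; now apply one_neq_zero in E1.
Qed.

Lemma preceq_sub z z' : valid z -> valid z' -> preceq z z' -> sub z z'.
Proof.
intros Hz Hz' [[Hf H]|(E & E' & H)]; [now apply below_sub|now apply not_below_sub].
Qed.

Lemma preceq_total z z' : valid z -> valid z' -> preceq z z' \/ preceq z' z.
Proof.
intros Hz Hz'; destruct (valid_fam z Hz) as [E|E], (valid_fam z' Hz') as [E'|E'].
- rewrite !preceq_same by congruence; apply below_total; congruence.
- rewrite (preceq_01 z z'), (preceq_10 z' z) by assumption; tauto.
- rewrite (preceq_10 z z'), (preceq_01 z' z) by assumption; tauto.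
- rewrite !preceq_same by congruence; apply below_total; congruence.
Qed.

Lemma sub_trans z1 z2 z3 : sub z1 z2 -> sub z2 z3 -> sub z1 z3.
Proof. intros [H1 H2] [H3 H4]; split; auto. Qed.

(** Within one family this is [below_trans]. From family 1 to family 0, [sub] gives [below]. In the
    remaining cases a failure would close a cycle of [sub], and [sub_below] would contradict a step
    from family 0 to family 1, which is a negated [below]. *)
Lemma preceq_trans z1 z2 z3 : valid z1 -> valid z2 -> valid z3 ->
  preceq z1 z2 -> preceq z2 z3 -> preceq z1 z3.
Proof.
intros V1 V2 V3 H12 H23.
pose proof (preceq_sub _ _ V1 V2 H12) as S12.
pose proof (preceq_sub _ _ V2 V3 H23) as S23.
destruct (valid_fam z1 V1) as [E1|E1], (valid_fam z3 V3) as [E3|E3].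
- apply preceq_same; [congruence|].
  destruct (valid_fam z2 V2) as [E2|E2].
  + apply preceq_same in H12, H23; try congruence.
    apply below_trans with z2; congruence.
  + destruct (below_total z1 z3) as [|H]; [assumption..|congruence|assumption|].
    exfalso; apply (proj1 (preceq_01 z1 z2 E1 E2) H12).
    apply sub_below; auto; apply (sub_trans _ z3); [exact S23|].
    apply below_sub; auto; left; congruence.
- apply preceq_01; auto; intros H.
  assert (S31 : sub z3 z1) by (apply below_sub; auto).
  destruct (valid_fam z2 V2) as [E2|E2].
  + apply (proj1 (preceq_01 z2 z3 E2 E3) H23); apply sub_below; auto.
    now apply (sub_trans _ z1).
  + apply (proj1 (preceq_01 z1 z2 E1 E2) H12); apply sub_below; auto.
    now apply (sub_trans _ z3).
- apply preceq_10; auto; apply sub_below; auto; now apply (sub_trans _ z2).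
- apply preceq_same; [congruence|].
  destruct (valid_fam z2 V2) as [E2|E2].
  + destruct (below_total z1 z3) as [|H]; [assumption..|congruence|assumption|].
    exfalso; apply (proj1 (preceq_01 z2 z3 E2 E3) H23).
    apply sub_below; auto; apply (sub_trans _ z1); [|exact S12].
    apply below_sub; auto; left; congruence.
  + apply preceq_same in H12, H23; try congruence.
    apply below_trans with z2; congruence.
Qed.

Lemma point_le_refl z : valid z -> point_le z z.
Proof.
intros Hz; split; [destruct (preceq_total z z Hz Hz); assumption|].
intros _; apply lt_succ_diag.
Qed.

Lemma point_le_total z z' : valid z -> valid z' -> point_le z z' \/ point_le z' z.
Proof.
intros Hz Hz'; unfold point_le.
pose proof (preceq_total z z' Hz Hz').
destruct (classic (code z < code z' + 1)) as [H1|H1]; [tauto|].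
apply nlt_succ in H1; apply lt_succ in H1.
assert (code z' < code z + 1).
{ apply lt_succ; destruct H1 as [H1|H1].
  - left; eapply lt_trans; [|exact H1]; apply lt_succ_diag.
  - left; rewrite <- H1; apply lt_succ_diag. }
tauto.
Qed.

Lemma point_le_trans z1 z2 z3 : valid z1 -> valid z2 -> valid z3 ->
  point_le z1 z2 -> point_le z2 z3 -> point_le z1 z3.
Proof.
intros V1 V2 V3 [H12 C12] [H23 C23]; split; [now apply (preceq_trans _ z2)|].
intros H31.
assert (C1 : code z1 < code z2 + 1) by (apply C12; now apply (preceq_trans _ z3)).
assert (C2 : code z2 < code z3 + 1) by (apply C23; now apply (preceq_trans _ z1)).
apply lt_succ in C1; destruct C1 as [C1| ->]; [|exact C2].
apply lt_succ; left; eapply lt_le_trans; eauto.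
Qed.

Lemma point_le_antisym z z' : point_le z z' -> point_le z' z -> code z = code z'.
Proof.
intros [H1 C1] [H2 C2]; specialize (C1 H2); specialize (C2 H1).
apply lt_succ in C1; destruct C1 as [C1|]; [|assumption].
apply lt_succ in C2; destruct C2 as [C2|]; [|now symmetry].
exfalso; apply (lt_irrefl (code z)); eapply lt_trans; eauto.
Qed.

(** * Incidence and the representation of the order *)

Definition incident (p : N) (z : point) : Prop :=
  cutL z (pr p 0) /\ ~ cutR z (pr p 0).

Lemma cut_rel z p q : p ≺ q -> cutL z (pr q 0) -> cutR z (pr p 0).
Proof.
intros H HL; apply NNPP; intros HR.
apply (cut_independent z (pr p 0) (pr q 0)); auto; now apply conflict_00.
Qed.

Lemma point_exists f a b : (f = 0 /\ exists v, b = pr v 0) \/ (f = 1 /\ exists u, a = pr u 0) ->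
  ~ conflict f b a -> exists z, valid z /\ fam z = f /\ cutL z a /\ ~ cutR z b.
Proof.
intros Hf H; assert (V : valid (Point f a b)).
{ split; [|exact H]; cbn [fam lo hi].
  destruct Hf as [[-> [v ->]]|[-> [u ->]]]; [left|right]; split; auto; eexists;
    (split; [apply pr_le_l|reflexivity]). }
exists (Point f a b); split; [exact V|split; [reflexivity|]].
split; [apply (cutL_lo _ V)|apply (cutR_hi _ V)].
Qed.

Lemma point_between p q : ~ p ≺ q ->
  exists z, valid z /\ cutL z (pr q 0) /\ ~ cutR z (pr p 0).
Proof.
intros H; destruct (point_exists 0 (pr q 0) (pr p 0)) as (z & Hz & _ & H1); eauto.
intros H1; now apply conflict_00_inv in H1.
Qed.

Lemma incident_exists p : exists z, valid z /\ incident p z.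
Proof.
destruct (point_between p p (R_irrefl p)) as (z & Hz & H); now exists z.
Qed.

(** A cut between the left endpoints [pos q] and [pos p] is translated by one unit, to separate the
    right endpoints. What killed [pr p 0] in [z] supplies the new initial items. *)
Lemma separated_LR z p q : valid z -> p \in P -> q \in P ->
  cutL z (pr q 0) -> ~ cutL z (pr p 0) ->
  exists z', valid z' /\ cutR z' (pr q 0) /\ ~ cutR z' (pr p 0).
Proof.
intros Hz Hp Hq HL HN; destruct (cutL_killer z _ Hz HN) as (b & H1 & H2 & _).
pose proof (cut_independent z b _ HL H1) as H3.
pose proof (conflict_inv _ _ _ H2) as H4.
destruct H4 as (u & v & [(E1 & -> & H4)|[(E & E1 & _)|(E & E1 & -> & Hu & Hv & H4)]]);
  apply pr_inj in E1; destruct E1 as [<- E1].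
- assert (Hvq : ninc v q).
  { repeat split; auto; [now apply R_dom in H4|].
    intros H; apply H3; now apply conflict_00. }
  destruct (point_exists 0 (pr v 1) (pr p 0)) as (z' & Hz' & Ef & H5 & H6); [eauto| |].
  { intros H; apply conflict_10_inv in H; now apply H. }
  exists z'; refine (conj Hz' (conj _ H6)); apply NNPP; intros H7.
  apply (cut_independent z' _ _ H5 H7); rewrite Ef; now apply conflict_10.
- symmetry in E1; now apply one_neq_zero in E1.
(* The killer is [pos v - 1], with [pos q < pos v - 1 <= pos p]; its translate is a cut between
   [pos v] and [pos p + 1]. *)
- assert (Hqv : q ≺ v).
  { apply NNPP; intros H; apply H3; rewrite E; now apply conflict_01. }
  destruct (point_between p v H4) as (z' & Hz' & H5 & H6).
  exists z'; refine (conj Hz' (conj _ H6)); now apply (cut_rel _ q v).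
Qed.

Lemma separated_RL z p q : valid z -> p \in P -> q \in P ->
  cutR z (pr q 0) -> ~ cutR z (pr p 0) ->
  exists z', valid z' /\ cutL z' (pr q 0) /\ ~ cutL z' (pr p 0).
Proof.
intros Hz Hp Hq HL HN; destruct (cutR_killer z _ Hz HL) as (a & H1 & H2 & _).
pose proof (cut_independent z _ a H1 HN) as H3.
pose proof (conflict_inv _ _ _ H2) as H4.
destruct H4 as (u & v & [(-> & E1 & H4)|[(E & -> & E1 & Hu & Hv & H4)|(E & _ & E1 & _)]]);
  apply pr_inj in E1; destruct E1 as [<- E1].
(* The killer is [pos u], with [pos q + 1 < pos u <= pos p + 1]; a cut of family 1 is started from
   [pos q] and [pos u - 1]. *)
- assert (Hpu : ninc p u).
  { repeat split; auto; [now apply R_dom in H4|].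
    intros H; apply H3; now apply conflict_00. }
  destruct (point_exists 1 (pr q 0) (pr u 1)) as (z' & Hz' & Ef & H5 & H6); [eauto| |].
  { intros H; apply conflict_01_inv in H; now apply H. }
  exists z'; refine (conj Hz' (conj H5 _)); intros H7.
  apply (cut_independent z' _ _ H7 H6); rewrite Ef; now apply conflict_01.
(* The killer is [pos u + 2], with [pos q <= pos u + 1 < pos p]; the new cut lies between [pos q]
   and [pos u + 1]. *)
- assert (Hup : u ≺ p).
  { apply NNPP; intros H; apply H3; rewrite E; now apply conflict_10. }
  destruct (point_between u q H4) as (z' & Hz' & H5 & H6).
  exists z'; refine (conj Hz' (conj H5 _)); intros H7; apply H6.
  now apply (cut_rel _ u p).
- symmetry in E1; now apply one_neq_zero in E1.
Qed.

(** Conversely, if [p] does not precede [q], some cut [z] has [pos q] on its left and [pos p + 1] on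
    its right. Any cut of [p] is after [z], or else [z] itself is a cut of [p]; dually for [q]. So
    some cut of [q] comes no later than some cut of [p]. *)
Lemma precedes_iff p q : p \in P -> q \in P ->
  p ≺ q <-> forall z z', valid z -> valid z' -> incident p z -> incident q z' ->
    ~ point_le z' z.
Proof.
intros Hp Hq; split.
- intros H z z' Hz Hz' [H1 H2] [H3 H4] [Hle _].
  apply (preceq_sub _ _ Hz' Hz) in Hle; apply H2, (cut_rel _ _ _ H); now apply Hle.
- intros H; apply NNPP; intros Hpq.
  destruct (point_between p q Hpq) as (z & Hz & H1 & H2).
  assert (Ep : exists zp, valid zp /\ incident p zp /\ point_le z zp).
  { destruct (incident_exists p) as (zp & Hzp & H3).
    destruct (point_le_total z zp Hz Hzp) as [H4|H4]; [now exists zp|].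
    exists z; split; [exact Hz|split; [|now apply point_le_refl]].
    split; [|exact H2]; apply proj1, (preceq_sub _ _ Hzp Hz) in H4; now apply H4, H3. }
  assert (Eq : exists zq, valid zq /\ incident q zq /\ point_le zq z).
  { destruct (incident_exists q) as (zq & Hzq & H3).
    destruct (point_le_total zq z Hzq Hz) as [H4|H4]; [now exists zq|].
    exists z; split; [exact Hz|split; [|now apply point_le_refl]].
    split; [exact H1|]; apply proj1, (preceq_sub _ _ Hz Hzq) in H4.
    intros H5; now apply H3, H4. }
  destruct Ep as (zp & Hzp & H3 & H4), Eq as (zq & Hzq & H5 & H6).
  apply (H zp zq Hzp Hzq H3 H5); now apply (point_le_trans _ z).
Qed.

(** This is what gives (i4). If [z] meets [q] but not [p], it separates two left or two right
    endpoints of [p] and [q]; the separation lemmas carry this over to the other two endpoints. Then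
    the new cut, or else any cut of [p], contradicts the inclusion. *)
Lemma incident_incl p q : p \in P -> q \in P ->
  (forall z, valid z -> incident p z -> incident q z) ->
  forall z, valid z -> incident q z -> incident p z.
Proof.
intros Hp Hq H z Hz [H1 H2]; apply NNPP; intros HN.
destruct (incident_exists p) as (zp & Hzp & H3).
destruct (classic (cutL z (pr p 0))) as [H4|H4].
- assert (H5 : cutR z (pr p 0)) by (apply NNPP; intros H5; now apply HN).
  destruct (separated_RL z q p Hz Hq Hp H5 H2) as (z' & Hz' & H6 & H7).
  destruct (classic (cutR z' (pr p 0))) as [H8|H8].
  + destruct (H zp Hzp H3) as [H9 H10].
    destruct (preceq_total zp z' Hzp Hz') as [H11|H11];
      apply preceq_sub in H11; auto; [now apply H7, H11|now apply H3, H11].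
  + now apply H7, (H z' Hz').
- destruct (separated_LR z p q Hz Hp Hq H1 H4) as (z' & Hz' & H6 & H7).
  destruct (classic (cutL z' (pr p 0))) as [H8|H8].
  + now apply (H z' Hz').
  + destruct (H zp Hzp H3) as [H9 H10].
    destruct (preceq_total zp z' Hzp Hz') as [H11|H11];
      apply preceq_sub in H11; auto; [now apply H8, H11, H3|now apply H10, H11].
Qed.

End ProperIntervalOrders.

(** * The characterization *)

Section Characterization.

Variables (e : nat -> N) (v : nat -> set M) (P R : set M).
Notation models := (sat M e (scons R (scons P v))).
Notation "x ≺ y" := (pr x y \in R /\ x <> y) (at level 70).

Hypothesis order : models (partial_order 1 0).

Lemma rel_dom x y : pr x y \in R -> x \in P /\ y \in P.
Proof.
destruct order as (H & _); intros Hxy; destruct (H _ Hxy) as (x' & y' & Hx & Hy & E).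
apply pr_inj in E; destruct E as [-> ->]; now split.
Qed.

Lemma rel_trans x y z : pr x y \in R -> pr y z \in R -> pr x z \in R.
Proof.
destruct order as (_ & _ & H & _); intros Hxy Hyz.
refine (H x y z _ _); [|now split].
destruct (rel_dom _ _ Hxy), (rel_dom _ _ Hyz); now repeat split.
Qed.

Lemma rel_antisym x y : pr x y \in R -> pr y x \in R -> x = y.
Proof.
destruct order as (_ & _ & _ & H); intros Hxy Hyx; refine (H x y _ _); [|now split].
exact (rel_dom _ _ Hxy).
Qed.

Lemma strict_rel_trans x y z : pr x y \in R -> y ≺ z -> x ≺ z.
Proof.
intros Hxy [Hyz Hne]; split; [now apply rel_trans with y|].
intros <-; apply Hne; now apply rel_antisym.
Qed.

(** A copy of 2+2 would give a cycle [x < y' <= x' < y <= x]. In a copy of 3+1, [F(q)] has points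
    [y] below and [u] above all of [F(p1)], so [F(p1)] is included in [F(q)] by convexity but omits
    [y], against (i4). *)
Lemma free_of_representation : models (proper_interval_order 1 0) ->
  models (And (no_two_plus_two 1 0) (no_three_plus_one 1 0)).
Proof.
intros (L & S & F & ((_ & _ & Htr & Has) & Htot) & _ & (Hne & Hconv) & Hi2 & Hi4).
set (le x y := pr x y \in S).
set (at_ p x := x \in L /\ pr p x \in F).
assert (Htr' : forall x y z, x \in L -> y \in L -> z \in L -> le x y -> le y z -> le x z).
{ intros x y z Hx Hy Hz H1 H2; refine (Htr x y z _ _); [now repeat split|now split]. }
assert (Has' : forall x y, x \in L -> y \in L -> le x y -> le y x -> x = y).
{ intros x y Hx Hy H1 H2; refine (Has x y _ _); now split. }
assert (Htot' : forall x y, x \in L -> y \in L -> le x y \/ le y x).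
{ intros x y Hx Hy; refine (Htot x y _); now split. }
assert (Hlt : forall p q x y, p \in P -> q \in P -> p ≺ q -> at_ p x -> at_ q y ->
  le x y /\ x <> y).
{ intros p q x y Hp Hq H H1 H2; exact (proj1 (Hi2 p q (conj Hp Hq)) H x y (conj H1 H2)). }
assert (Hnlt : forall p q, p \in P -> q \in P -> ~ p ≺ q ->
  exists x y, at_ p x /\ at_ q y /\ le y x).
{ intros p q Hp Hq H; apply NNPP; intros HN; apply H, (proj2 (Hi2 p q (conj Hp Hq))).
  intros x y [H1 H2].
  assert (Hyx : ~ le y x) by (intros H3; apply HN; now exists x, y).
  destruct (Htot' x y (proj1 H1) (proj1 H2)) as [H3|H3]; [|contradiction].
  split; [exact H3|]; change (x <> y); intros ->; contradiction. }
split.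
- intros p0 q0 p1 q1 (Hp0 & Hq0 & Hp1 & Hq1) [H0 H1].
  change (p0 ≺ q0) in H0; change (p1 ≺ q1) in H1.
  change (pr p0 q1 \in R \/ pr p1 q0 \in R); apply NNPP; intros HN.
  destruct (Hnlt p0 q1) as (x & y & Hx & Hy & Hyx); auto; [tauto|].
  destruct (Hnlt p1 q0) as (x' & y' & Hx' & Hy' & Hyx'); auto; [tauto|].
  destruct (Hlt p0 q0 x y') as [H2 H3]; auto.
  destruct (Hlt p1 q1 x' y) as [H4 H5]; auto.
  apply H3, Has'; try apply Hx; try apply Hy'; auto.
  apply (Htr' _ x'); try apply Hx; try apply Hy'; try apply Hx'; auto.
  apply (Htr' _ y); try apply Hx; try apply Hy; try apply Hx'; auto.
- intros p0 p1 p2 q (Hp0 & Hp1 & Hp2 & Hq) [H0 H1].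
  change (p0 ≺ p1) in H0; change (p1 ≺ p2) in H1.
  change (pr p0 q \in R \/ pr q p2 \in R); apply NNPP; intros HN.
  destruct (Hnlt p0 q) as (x & y & Hx & Hy & Hyx); auto; [tauto|].
  destruct (Hnlt q p2) as (u & w & Hu & Hw & Hwu); auto; [tauto|].
  assert (Hyz : forall z, at_ p1 z -> le y z /\ y <> z).
  { intros z Hz; destruct (Hlt p0 p1 x z) as [H2 H3]; auto; split.
    - apply (Htr' _ x); try apply Hx; try apply Hy; try apply Hz; auto.
    - intros ->; apply H3, Has'; try apply Hx; try apply Hz; auto. }
  assert (Hzu : forall z, at_ p1 z -> le z u /\ z <> u).
  { intros z Hz; destruct (Hlt p1 p2 z w) as [H2 H3]; auto; split.
    - apply (Htr' _ w); try apply Hu; try apply Hw; try apply Hz; auto.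
    - intros ->; apply H3, Has'; try apply Hu; try apply Hw; auto. }
  assert (Hincl : forall z, at_ p1 z -> at_ q z).
  { intros z Hz; refine (Hconv q Hq y u z _ _).
    - split; [exact Hy|split; [exact Hu|apply Hz]].
    - split; [exact (Hyz z Hz)|exact (Hzu z Hz)]. }
  apply (Hyz y); [|reflexivity].
  apply (proj2 (Hi4 p1 q (conj Hp1 Hq) Hincl y)); exact Hy.
Qed.

Lemma representation_of_free :
  models (And (no_two_plus_two 1 0) (no_three_plus_one 1 0)) ->
  models (proper_interval_order 1 0).
Proof.
intros [H22 H31].
assert (R_dom : forall x y, x ≺ y -> x \in P /\ y \in P).
{ intros x y [H _]; now apply rel_dom. }
assert (R_22 : forall a b c d, a ≺ b -> c ≺ d -> a ≺ d \/ c ≺ b).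
{ intros a b c d Hab Hcd; destruct (R_dom _ _ Hab), (R_dom _ _ Hcd).
  assert (H3 : pr a d \in R \/ pr c b \in R).
  { refine (H22 a b c d _ _); [now repeat split|exact (conj Hab Hcd)]. }
  (* The strict form needed for cuts: [a = d] gives [c <= a < b], and [c = b] gives [a <= c < d]. *)
  destruct (classic (a = d)) as [<-|Had].
  { right; apply strict_rel_trans with a; [apply Hcd|exact Hab]. }
  destruct (classic (c = b)) as [<-|Hcb].
  { left; apply strict_rel_trans with c; [apply Hab|exact Hcd]. }
  tauto. }
assert (R_31 : forall a b c d, a ≺ b -> b ≺ c -> d \in P -> a ≺ d \/ d ≺ c).
{ intros a b c d Hab Hbc Hd; destruct (R_dom _ _ Hab), (R_dom _ _ Hbc).
  assert (H4 : pr a d \in R \/ pr d c \in R).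
  { refine (H31 a b c d _ _); [now repeat split|exact (conj Hab Hbc)]. }
  assert (Hac : a ≺ c) by (apply strict_rel_trans with b; [apply Hab|exact Hbc]).
  destruct (classic (a = d)) as [<-|Had]; [now right|].
  destruct (classic (d = c)) as [->|Hcb]; [now left|].
  tauto. }
(* Points, order and incidence are all [D0], which brings them within reach of comprehension. *)
destruct (D0_comprehension (fun x => decoded x (valid P R)) (points_D0 P R)) as [L HL].
destruct (D2_comprehension _ (point_le_D2 P R)) as (S & HS & HS').
destruct (D2_comprehension _ (incidence_D2 P R)) as (F & HF & HF').
assert (HLc : forall z, code z \in L <-> valid P R z).
{ intros z; rewrite HL; now apply decoded_code. }
assert (HLi : forall x, x \in L -> exists z, x = code z /\ valid P R z).
{ intros x Hx; apply HL in Hx; now apply decoded_inv in Hx. }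
assert (HSc : forall z z', pr (code z) (code z') \in S <->
  valid P R z /\ valid P R z' /\ point_le P R z z').
{ intros z z'; rewrite HS, !decoded_code; reflexivity. }
assert (HFc : forall p z, pr p (code z) \in F <->
  p \in P /\ valid P R z /\ incident P R p z).
{ intros p z; rewrite HF, decoded_code; reflexivity. }
exists L, S, F.
refine (conj (conj (conj _ (conj _ (conj _ _))) _) (conj _ (conj (conj _ _) (conj _ _)))).
- intros n Hn; change (n \in S) in Hn; apply HS' in Hn; destruct Hn as (x & y & -> & H).
  apply decoded_inv in H; destruct H as (z & -> & H).
  apply decoded_inv in H; destruct H as (z' & -> & Hz & Hz' & _).
  exists (code z), (code z'); split; [now apply HLc|split; [now apply HLc|reflexivity]].
- intros x Hx; destruct (HLi x Hx) as (z & -> & Hz); apply HSc.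
  refine (conj Hz (conj Hz _)); now apply point_le_refl.
- intros x y z (Hx & Hy & Hz) [H1 H2].
  destruct (HLi x Hx) as (a & -> & Ha), (HLi y Hy) as (b & -> & Hb), (HLi z Hz) as (c & -> & Hc).
  apply HSc in H1, H2; apply HSc; refine (conj Ha (conj Hc _)).
  apply (point_le_trans P R R_dom R_22 R_31 _ b); tauto.
- intros x y [Hx Hy] [H1 H2].
  destruct (HLi x Hx) as (a & -> & Ha), (HLi y Hy) as (b & -> & Hb).
  apply HSc in H1, H2; apply (point_le_antisym P R); tauto.
- intros x y [Hx Hy]; destruct (HLi x Hx) as (a & -> & Ha), (HLi y Hy) as (b & -> & Hb).
  destruct (point_le_total P R R_dom R_22 R_31 a b Ha Hb); [left|right];
    now apply HSc.
- intros n Hn; change (n \in F) in Hn; apply HF' in Hn; destruct Hn as (p & x & -> & Hp & H).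
  apply decoded_inv in H; destruct H as (z & -> & Hz & _).
  exists p, (code z); split; [exact Hp|split; [now apply HLc|reflexivity]].
- intros p Hp; destruct (incident_exists P R p) as (z & Hz & H).
  exists (code z); split; [now apply HLc|now apply HFc].
- intros p Hp x y z ((Hx & Hpx) & (Hy & Hpy) & Hz) [[H1 _] [H2 _]].
  destruct (HLi x Hx) as (a & -> & Ha), (HLi y Hy) as (b & -> & Hb), (HLi z Hz) as (c & -> & Hc).
  split; [exact Hz|]; apply HFc; refine (conj Hp (conj Hc _)).
  apply HFc in Hpx, Hpy; apply HSc in H1, H2.
  destruct H1 as (_ & _ & H1 & _), H2 as (_ & _ & H2 & _).
  apply (preceq_sub P R R_dom R_22 R_31) in H1, H2; auto.
  split; [apply H1, Hpx|intros H; now apply Hpy, H2].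
- intros p q [Hp Hq].
  pose proof (precedes_iff P R R_dom R_22 R_31 p q Hp Hq) as Hiff.
  split; intros H.
  + intros x y [[Hx Hpx] [Hy Hqy]].
    destruct (HLi x Hx) as (a & -> & Ha), (HLi y Hy) as (b & -> & Hb).
    apply HFc in Hpx, Hqy.
    assert (Hba : ~ point_le P R b a) by (apply Hiff; tauto).
    split.
    * apply HSc; refine (conj Ha (conj Hb _)).
      destruct (point_le_total P R R_dom R_22 R_31 a b Ha Hb); tauto.
    * change (code a <> code b); intros E; apply code_inj in E; subst b.
      apply Hba; now apply point_le_refl.
  + apply Hiff; intros a b Ha Hb Hpa Hqb Hba.
    destruct (H (code a) (code b)) as [H1 H2].
    { split; split; try (now apply HLc); now apply HFc. }
    apply H2, (point_le_antisym P R); [|exact Hba].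
    now apply HSc in H1.
- intros p q [Hp Hq] H x; split; [apply H|].
  intros [Hx Hqx]; split; [exact Hx|].
  destruct (HLi x Hx) as (a & -> & Ha); apply HFc in Hqx; apply HFc.
  refine (conj Hp (conj Ha _)).
  apply (incident_incl P R R_dom R_22 R_31 p q Hp Hq); try tauto.
  intros z Hz Hpz.
  assert (Hz' : code z \in L /\ pr q (code z) \in F).
  { apply (H (code z)); split; [now apply HLc|now apply HFc]. }
  now apply proj2, HFc in Hz'.
Qed.

End Characterization.

End Models.

Theorem theorem1p3 :
  provable RCA0
    (AllS (AllS (
      let P := 1 in let R := 0 in
      partial_order P R ==>
      (proper_interval_order P R <==>
       no_two_plus_two P R /\ no_three_plus_one P R)))).
Proof.
apply completeness; intros M RCA e v P R Hpo; split.
- exact (free_of_representation M e v P R).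
- exact (representation_of_free M v RCA e v P R Hpo).
Qed.
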